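(* Let $\chi:\mathbb N\to(0,\infty)$ be a function with $\lim_{m\to\infty}\chi(m)=0$. For every $\xi>0$ and every $p\ge2$ there exist positive constants $\kappa=\kappa(\xi)$, $C=C(\xi)$ (depending only on $\xi$) and $C'=C'(\xi,\chi)$ (depending only on $\xi$ and $\chi$) such that the following holds. For every $m\in\mathbb N$ and every $\rho\in[0,1]$ satisfying $$\frac{\kappa\log m}{m}\le\rho\le\frac{\chi(m)\,m^{1/3}}{m},$$ with probability at least $1-\frac{C'}{m^{\xi}}$ a random graph $G\in\mathbb G(m,\rho)$ satisfies $$\forall p'\in[2,p],\qquad \lambda_{1,p'}(G)\ge 1-\frac{C p^{4}}{(\rho m)^{1/(2p^{2})}}-\frac{C\sqrt{\log m}}{(\rho m)^{1/2}}\,\mathbb I_{p'<3},$$ where $\mathbb I_{p'<3}=1$ if $p'<3$ and $\mathbb I_{p'<3}=0$ otherwise.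
   Context: $\mathbb G(m,\rho)$ is the model of random simple graphs on $m$ vertices in which each pair of vertices is joined by an edge independently with probability $\rho$. For a graph $G$ with vertex set $G_0$ and edge set $G_1$, $\mathrm{val}(u)$ is the valency of $u\in G_0$. For $p\in(1,\infty)$ and $t\in\mathbb R$ put $\{t\}^{p-1}=\mathrm{sign}(t)|t|^{p-1}$, $\{0\}^{p-1}=0$. The graph $p$-Laplacian is the operator on $\mathbb R^{G_0}$ given by $(\Delta_px)(u)=\frac1{\mathrm{val}(u)}\sum_{e\in G_1 \text{ with endpoints } u,v}\{x_u-x_v\}^{p-1}$. A real $\lambda$ is an eigenvalue of $\Delta_p$ if there is a non-zero $x\in\mathbb R^{G_0}$ (an eigenfunction) with $\Delta_px=\lambda\{x\}^{p-1}$, and $\lambda_{1,p}(G)$ is the smallest eigenvalue of $\Delta_p$ corresponding to a non-constant eigenfunction. Equivalently, $\lambda_{1,p}(G)=\inf\left\{\frac{\sum_{e\in G_1}|dx(e)|^p}{\inf_{c\in\mathbb R}\sum_{u\in G_0}|x_u-c|^p\,\mathrm{val}(u)}: x\in\mathbb R^{G_0}\text{ non-constant}\right\}$, where $|dx(e)|=|x_u-x_v|$ if $e$ has endpoints $u,v$. *)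

(* Defs.v *)
From HB Require Import structures.
From mathcomp Require Import all_boot all_order all_algebra.
From mathcomp Require Import all_classical all_reals all_analysis.
Set Implicit Arguments.
Unset Strict Implicit.
Unset Printing Implicit Defensive.
Import Order.TTheory GRing.Theory Num.Theory.
Import numFieldNormedType.Exports.
Local Open Scope ring_scope.

(* Finite simple graphs on the vertex set V, given by their edge sets:
   an edge is a subset of V with exactly two elements. *)
Definition sgraph (V : finType) : finType :=
  {E : {set {set V}} | [forall e in E, (#|e| == 2)%N]}.

(* [set u; u] is a singleton, so adj is irreflexive. *)
Definition adj (V : finType) (G : sgraph V) (u v : V) : bool :=
  [set u; v] \in val G.

Definition valency (V : finType) (G : sgraph V) (u : V) : nat :=
  #|[set v | adj G u v]|.

(* spow t a is {t}^a = sign(t) |t|^a, with {0}^a = 0. *)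
Definition spow (R : realType) (t a : R) : R := Num.sg t * `|t| `^ a.

(* At a vertex of valency 0 the sum is empty and (Delta_p x)(u) = 0. *)
Definition plaplacian (R : realType) (V : finType) (G : sgraph V) (p : R)
    (x : V -> R) (u : V) : R :=
  (valency G u)%:R^-1 * \sum_(v | adj G u v) spow (x u - x v) (p - 1).

Definition eigenfunction (R : realType) (V : finType) (G : sgraph V)
    (p lambda : R) (x : V -> R) : Prop :=
  (exists u, x u != 0) /\
  (forall u, plaplacian G p x u = lambda * spow (x u) (p - 1)).

Definition nonconstant (R : realType) (V : finType) (x : V -> R) : Prop :=
  exists u v, x u != x v.

Definition nonconstant_eigenvalue (R : realType) (V : finType) (G : sgraph V)
    (p lambda : R) : Prop :=
  exists x : V -> R, eigenfunction G p lambda x /\ nonconstant x.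

(* The smallest eigenvalue with a non-constant eigenfunction.  The default
   value 0 of xget is only used when there is none, e.g. when #|V| <= 1. *)
Definition lambda1 (R : realType) (V : finType) (G : sgraph V) (p : R) : R :=
  xget 0 [set l | nonconstant_eigenvalue G p l /\
                  forall l', nonconstant_eigenvalue G p l' -> l <= l']%classic.

Definition gnp_weight (R : realType) (m : nat) (rho : R)
    (G : sgraph 'I_m) : R :=
  \prod_(e : {set 'I_m} | (#|e| == 2)%N) (if e \in val G then rho else 1 - rho).

(* Probability of the event A in the random graph model G(m, rho). *)
Definition gnp_prob (R : realType) (m : nat) (rho : R)
    (A : sgraph 'I_m -> Prop) : R :=
  \sum_(G : sgraph 'I_m | `[< A G >]) gnp_weight rho G.

(* Main.v *)
Require Import Defs.
From HB Require Import structures.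
From mathcomp Require Import all_boot all_order all_algebra.
From mathcomp Require Import all_classical all_reals all_analysis.
From mathcomp Require Import ring lra zify.
Set Implicit Arguments.
Unset Strict Implicit.
Unset Printing Implicit Defensive.
Import Order.TTheory GRing.Theory Num.Theory.
Import numFieldNormedType.Exports.
Local Open Scope ring_scope.

(** Write d = rho m for the expected degree and N(x) = sum_u val(u) |x_u|^p,
    E(x) = sum over edges of |x_u - x_v|^p.  A non-constant eigenfunction with
    eigenvalue l <> 0 satisfies sum_u val(u) {x_u}^(p-1) = 0 (call such an x
    balanced) and l = E(x) / N(x), so everything reduces to a lower bound
    E(x) >= (1 - eps) N(x) over balanced x.  Such a bound passes to lambda1 once
    lambda1 is known to be attained, which is a compactness argument in the
    space of vertex functions ([lambda1_ge]).

    The lower bound on E comes from the ordinary (p = 2) spectral gap, uniformly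
    in p.  For p >= 2 there is the pointwise inequality [powR_dist_ge]
      |a-b|^p >= |a|^p + |b|^p - p ({a}^(p-1) b + {b}^(p-1) a)
                 + p a b min(|a|,|b|)^(p-2).
    Summed over edges, the first two terms give N(x).  The kernel
    a b min(|a|,|b|)^(p-2) is an integral of products of truncations of x, hence
    positive definite, and the adjacency matrix is bounded below on such kernels
    up to the spectral error delta.  In the mixed terms the balance condition
    removes the rank-one part of the adjacency matrix; what remains is estimated
    by interpolation between the L^2 bound delta and the trivial L^oo bound,
    which yields an error of order delta^(1/(p-1)) ([spow_bilinear_le],
    [energy_ge]).

    The spectral gap delta = O(d^(-1/8)), relative to the degrees, comes from
    discrepancy: with high probability the number of edges between any two
    vertex sets S, T deviates from rho |S||T| by at most O(d^(3/4)) sqrt(|S||T|).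
    This is a Chernoff bound plus a union bound over sets
    ([pseudorandom_prob]), where very unbalanced pairs are covered by the degree
    bound instead.  A dyadic decomposition of the entries of two vectors turns
    discrepancy into a bound for the bilinear form of A - rho (J - I)
    ([dyadic_bilinear_le]), at the price of a factor d^(1/8), and
    passing to vectors orthogonal to the degrees absorbs the rank-one part
    ([spectral_gap_centered]).

    Finally (d^(-1/8))^(1/(p-1)) <= d^(-1/(2p^2)) is (p - 2)^2 >= 0.  Throughout
    the probabilistic part a = d^(1/8), so that all powers of d that occur are
    integer powers of a. *)

(** * Pointwise inequalities for powers *)

Section pointwise.
Variable R : realType.
Implicit Types a b h p t : R.

Lemma norm_spow a p : 0 < p -> `|spow a p| = `|a| `^ p.
Proof.
move=> p0; rewrite /spow normrM norm_powR// normr_id.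
have [->|a0] := eqVneq a 0; first by rewrite normr0 powR0 ?gt_eqF// mulr0.
by rewrite normr_sg a0 mul1r.
Qed.

Lemma spowE a p : 1 <= p -> spow a p = a * `|a| `^ (p - 1).
Proof.
move=> p1; rewrite /spow {3}[a]numEsg -mulrA mulr_powRB1//; lra.
Qed.

Lemma spowN a p : spow (- a) p = - spow a p.
Proof. by rewrite /spow sgrN normrN mulNr. Qed.

Lemma mul_spow a p : 0 < p -> a * spow a p = `|a| `^ (p + 1).
Proof.
move=> p0; rewrite /spow mulrA (mulrC a) -normrEsg.
by rewrite -(@mulr_powRB1 _ _ (p + 1))// ?addrK//; lra.
Qed.

(** Young's inequality with exponents p and p/(p-1), applied to |b| and
    |a|^(p-1), is the statement that |.|^p lies above its tangent at a. *)
Lemma powR_tangent a b p : 1 < p ->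
  `|a| `^ p + p * (spow a (p - 1) * (b - a)) <= `|b| `^ p.
Proof.
move=> p1.
have p0 : 0 < p by lra.
have q0 : 0 < p / (p - 1) by rewrite divr_gt0; lra.
have pm : p - 1 != 0 by rewrite gt_eqF; lra.
have H : p^-1 + (p / (p - 1))^-1 = 1.
  by rewrite invf_div; field; rewrite gt_eqF.
have := conjugate_powR (normr_ge0 b) (powR_ge0 `|a| (p - 1)) p0 q0 H.
rewrite -powRrM (_ : (p - 1) * (p / (p - 1)) = p); last by field.
rewrite invf_div => Y.
have : spow a (p - 1) * b <= `|b| * `|a| `^ (p - 1).
  have <- : `|spow a (p - 1)| = `|a| `^ (p - 1) by apply: norm_spow; lra.
  by rewrite [leRHS]mulrC -normrM; apply: ler_norm.
move=> /le_trans/(_ Y); rewrite -(ler_pM2l p0).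
have -> : p * (`|b| `^ p / p + `|a| `^ p * ((p - 1) / p)) =
  `|b| `^ p + (p - 1) * `|a| `^ p by field; rewrite gt_eqF.
have := @mul_spow a (p - 1); rewrite subrK => /(_ ltac:(lra)) E.
rewrite !mulrBr (mulrC _ a) E => ?; lra.
Qed.

Lemma bernoulli_powR t p : 1 <= p -> -1 <= t -> 1 + p * t <= (1 + t) `^ p.
Proof.
rewrite le_eqVlt => /predU1P[<- t1|p1 t1].
  by rewrite powRr1 ?mul1r//; lra.
have := @powR_tangent 1 (1 + t) p p1.
rewrite normr1 powR1 (@ger0_norm _ (1 + t)); last lra.
by rewrite /spow sgr1 normr1 powR1 !mul1r addrAC subrr add0r.
Qed.

(** Scaling by a reduces to (1-c)^p with |c| <= 1.  Writing it as
    (1-c) (1-c)^(p-1) and applying Bernoulli to the second factor leaves the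
    quadratic excess (p-1) c^2, which dominates |c|^p. *)
Lemma powR_dist_ge_max a b p : 2 <= p -> `|b| <= `|a| ->
  `|a| `^ p + `|b| `^ p - p * (spow a (p - 1) * b) <= `|a - b| `^ p.
Proof.
move=> p2 ba.
have [a0|a0] := eqVneq a 0.
  move: ba; rewrite a0 normr0 normr_le0 => /eqP->.
  by rewrite mulr0 subr0 normr0 powR0 ?mulr0; [lra|rewrite gt_eqF//; lra].
pose c := b / a; have bE : b = a * c by rewrite /c mulrC divfK.
clearbody c; have c1 : `|c| <= 1.
  by move: ba; rewrite bE normrM ger_pMr// normr_gt0.
have [c1l c1r] : -1 <= c /\ c <= 1 by move: c1; rewrite ler_norml => /andP.
have -> : a - b = a * (1 - c) by rewrite bE; ring.
have -> : spow a (p - 1) * b = `|a| `^ p * c.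
  have := @mul_spow a (p - 1); rewrite subrK => /(_ ltac:(lra)) <-.
  by rewrite bE; ring.
rewrite bE !normrM !powRM// (@ger0_norm _ (1 - c)); [|lra].
have -> : `|a| `^ p + `|a| `^ p * `|c| `^ p - p * (`|a| `^ p * c) =
  `|a| `^ p * (1 + `|c| `^ p - p * c) by ring.
rewrite ler_wpM2l ?powR_ge0//.
rewrite -(@mulr_powRB1 _ (1 - c)); [|lra|lra].
have := @bernoulli_powR (- c) (p - 1) ltac:(lra) ltac:(lra) => B.
apply: (@le_trans _ _ ((1 - c) * (1 + (p - 1) * - c))); last first.
  by rewrite ler_wpM2l//; lra.
have cc : `|c| `^ p <= c ^+ 2.
  have [->|c0] := eqVneq c 0.
    by rewrite normr0 powR0 ?expr0n//=; rewrite gt_eqF//; lra.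
  rewrite -real_normK ?num_real// -powR_mulrn//.
  by apply: ger_powR => //; rewrite c1 normr_gt0 c0.
have : 0 <= c ^+ 2 by apply: sqr_ge0.
rewrite expr2 in cc *; nra.
Qed.

(** Symmetric form of [powR_dist_ge_max]: when |b| <= |a|, the last term
    cancels the mixed term {b}^(p-1) a.  It cannot be dropped for p < 3 (take
    a = 1, b = -1), but being a positive definite kernel in a, b it costs
    little when summed against the adjacency matrix of an expander. *)
Lemma powR_dist_ge a b p : 2 <= p ->
  `|a| `^ p + `|b| `^ p - p * (spow a (p - 1) * b + spow b (p - 1) * a)
    + p * (a * b * Num.min (`|a| `^ (p - 2)) (`|b| `^ (p - 2)))
  <= `|a - b| `^ p.
Proof.
move=> p2.
wlog ba : a b / `|b| <= `|a|.
  move=> W; have [ba|/ltW ab] := leP `|b| `|a|; first exact: W.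
  rewrite distrC minC; apply: le_trans (W _ _ ab); lra.
have -> : Num.min (`|a| `^ (p - 2)) (`|b| `^ (p - 2)) = `|b| `^ (p - 2).
  by rewrite min_r// ge0_ler_powR ?nnegrE//; lra.
apply: le_trans (powR_dist_ge_max p2 ba).
have -> : spow b (p - 1) = b * `|b| `^ (p - 2).
  by rewrite spowE; [congr (_ * _ `^ _); ring|lra].
lra.
Qed.

Lemma sqr_mul_powR (x p : R) : 2 <= p -> x ^+ 2 * `|x| `^ (p - 2) = `|x| `^ p.
Proof.
move=> p2; rewrite -real_normK ?num_real// -powR_mulrn//.
have [->|x0] := eqVneq x 0; last first.
  by rewrite -powRD ?normr_eq0 ?x0 ?implybT//; congr (_ `^ _); ring.
by rewrite normr0 powR0// mul0r powR0//; rewrite gt_eqF//; lra.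
Qed.

End pointwise.

(** * Layer-cake decomposition of a minimum *)

Section layer_cake.
Variables (R : realType) (V : finType).

(** Since min(s, s') is the integral over t >= 0 of 1_(t<s) 1_(t<s'), an
    inequality between all pairs of superlevel sets integrates to one with the
    kernel min.  As h and k take finitely many values the integral is a finite
    sum, built here by repeatedly removing the lowest positive level. *)
Lemma layer_cake_min (K : V -> V -> R) (a b h k : V -> R) :
  (forall u, 0 <= h u) -> (forall u, 0 <= k u) ->
  (forall t : R, 0 <= t ->
     - (\sum_u a u * (t < h u)%R%:R + \sum_v b v * (t < k v)%R%:R) <=
     \sum_u \sum_v K u v * ((t < h u)%R%:R * (t < k v)%R%:R)) ->
  - (\sum_u a u * h u + \sum_v b v * k v) <=
    \sum_u \sum_v K u v * Num.min (h u) (k v).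
Proof.
have [n] := ubnP (#|[set u | 0 < h u]| + #|[set u | 0 < k u]|).
elim: n h k => // n IH h k; rewrite ltnS => card_n h0 k0 H.
pose w (i : V + V) := match i with inl u => h u | inr u => k u end.
case: (pickP (fun i => 0 < w i)) => [i0 wi0|w0]; last first.
  have hE u : h u = 0.
    by apply/eqP; rewrite eq_le h0 leNgt; have /= -> := w0 (inl u).
  have kE u : k u = 0.
    by apply/eqP; rewrite eq_le k0 leNgt; have /= -> := w0 (inr u).
  under eq_bigr do rewrite hE mulr0.
  under [X in _ + X]eq_bigr do rewrite kE mulr0.
  rewrite !big1_eq addr0 oppr0 big1// => u _; rewrite big1// => v _.
  by rewrite hE kE minxx mulr0.
case: (@arg_minP _ R (V + V)%type i0 (fun i => 0 < w i) w wi0) => {wi0} {i0} i wi wmin.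
set m := w i in wi wmin.
pose cut (x : R) := Num.max 0 (x - m).
have hm u : 0 < h u -> m <= h u by move=> hu; apply: (wmin (inl u)).
have km u : 0 < k u -> m <= k u by move=> ku; apply: (wmin (inr u)).
have cutE (x : R) : 0 <= x -> (0 < x -> m <= x) -> x = cut x + m * (0 < x)%R%:R.
  rewrite le_eqVlt => /predU1P[<- _|x0 /(_ x0) mx].
    rewrite /cut ltxx mulr0 addr0 max_l//; lra.
  by rewrite /cut x0 mulr1 max_r ?subrK// subr_ge0.
have cut_ge0 x : 0 <= cut x by rewrite /cut le_max lexx.
have cut_gt (t x : R) : 0 <= t -> (t < cut x) = (t + m < x).
  by move=> t0; rewrite /cut lt_max ltNge t0/= ltrBrDr.
have {}IH := IH (cut \o h) (cut \o k).
have Hc : (#|[set u | (0 < (cut \o h) u)%R]| + #|[set u | (0 < (cut \o k) u)%R]| < n)%N.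
  apply: leq_trans card_n.
  have sub (g : V -> R) : [set u | 0 < (cut \o g) u] \subset [set u | 0 < g u].
    apply/fintype.subsetP => u; rewrite !inE /= cut_gt// add0r; lra.
  (* a point where the lowest level m is attained leaves the support *)
  have [[u um]|[u um]] : (exists u, h u = m) \/ (exists u, k u = m).
    by rewrite /m; case: (i) => u; [left|right]; exists u.
  - rewrite -addSn leq_add ?subset_leq_card// proper_card// properE sub.
    by apply/fintype.subsetPn; exists u; rewrite !inE/= ?cut_gt// ?add0r um ?ltxx.
  - rewrite -addnS leq_add ?subset_leq_card// proper_card// properE sub.
    by apply/fintype.subsetPn; exists u; rewrite !inE/= ?cut_gt// ?add0r um ?ltxx.
have {IH Hc} := IH Hc (fun u => cut_ge0 _) (fun u => cut_ge0 _).
have Ht t : 0 <= t ->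
     - (\sum_u a u * (t < (cut \o h) u)%R%:R + \sum_v b v * (t < (cut \o k) v)%R%:R) <=
     \sum_u \sum_v K u v * ((t < (cut \o h) u)%R%:R * (t < (cut \o k) v)%R%:R).
  move=> t0; have tm : 0 <= t + m by lra.
  under eq_bigr do rewrite /= (cut_gt _ _ t0).
  under [X in _ + X]eq_bigr do rewrite /= (cut_gt _ _ t0).
  apply: le_trans (H _ tm) _.
  rewrite le_eqVlt; apply/orP; left; apply/eqP.
  by apply: eq_bigr => u _; apply: eq_bigr => v _; rewrite /= !cut_gt.
move=> /(_ Ht) IH {Ht}.
have {}H := H 0 (lexx 0).
have splitS (c g : V -> R) : (forall u, 0 <= g u) -> (forall u, 0 < g u -> m <= g u) ->
    \sum_u c u * g u = \sum_u c u * (cut \o g) u + m * \sum_u c u * (0 < g u)%R%:R.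
  move=> g0 gm; rewrite mulr_sumr -big_split/=; apply: eq_bigr => u _.
  rewrite {1}(cutE (g u))//; [ring|exact: gm].
have -> : \sum_u \sum_v K u v * Num.min (h u) (k v) =
   \sum_u \sum_v K u v * Num.min ((cut \o h) u) ((cut \o k) v)
   + m * \sum_u \sum_v K u v * ((0 < h u)%R%:R * (0 < k v)%R%:R).
  rewrite mulr_sumr -big_split/=; apply: eq_bigr => u _.
  rewrite mulr_sumr -big_split/=; apply: eq_bigr => v _.
  rewrite [_ * (K u v * _)]mulrCA -mulrDr; congr (_ * _).
  move: (h0 u) (k0 v); rewrite le_eqVlt => /predU1P[<-|hu].
    rewrite !ltxx mul0r mulr0 addr0 min_l// => kv.
    by rewrite /cut max_l ?min_l// ?le_max ?lexx//; lra.
  rewrite le_eqVlt => /predU1P[<-|kv].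
    rewrite ltxx !mulr0 addr0 min_r// 1?ltW//.
    by rewrite /cut (@max_l _ _ 0 (0 - m)) ?min_r// ?le_max ?lexx//; lra.
  rewrite {1}(cutE _ (ltW hu) (hm _)) {1}(cutE _ (ltW kv) (km _)).
  by rewrite hu kv mul1r mulr1 addr_minl.
rewrite (splitS a h)// (splitS b k)//.
have := ler_wpM2l (ltW wi) H; lra.
Qed.

End layer_cake.

(** * From a spectral gap to the p-energy *)

(** The weights A without the rank-one part d d^T / vol, which is the
    stationary projection of the random walk; relative to d its norm is the
    second largest modulus of an eigenvalue of that walk. *)
Definition centered_adj (R : realType) (V : finType) (A : V -> V -> R)
    (d : V -> R) (u v : V) : R :=
  A u v - d u * d v / \sum_w d w.

Section energy.
Variables (R : realType) (V : finType) (A : V -> V -> R) (d : V -> R).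
Hypothesis A_ge0 : forall u v, 0 <= A u v.
Hypothesis A_sym : forall u v, A u v = A v u.
Hypothesis dE : forall u, d u = \sum_v A u v.
Let vol := \sum_u d u.
Hypothesis vol_gt0 : 0 < vol.

Let B := centered_adj A d.

Lemma rowsum_ge0 u : 0 <= d u.
Proof. by rewrite dE sumr_ge0. Qed.

Lemma centered_adj_sum f g : \sum_u \sum_v A u v * (f u * g v) =
  \sum_u \sum_v B u v * (f u * g v)
  + (\sum_u d u * f u) * (\sum_v d v * g v) / vol.
Proof.
rewrite mulr_suml mulr_suml -big_split/=; apply: eq_bigr => u _.
rewrite mulr_sumr mulr_suml -big_split/=; apply: eq_bigr => v _.
rewrite /B /centered_adj -/vol; ring.
Qed.

Lemma centered_adj_rowsum u : \sum_v `|B u v| <= 2 * d u.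
Proof.
apply: (@le_trans _ _ (\sum_v (A u v + d u * d v / vol))).
  apply: ler_sum => v _; apply: le_trans (ler_normB _ _) _.
  rewrite !ger0_norm// ?divr_ge0 ?mulr_ge0 ?rowsum_ge0//; exact: ltW.
rewrite big_split/= -dE -mulr_suml -mulr_sumr -/vol mulfK ?gt_eqF//; lra.
Qed.

Variables (delta : R).
Hypothesis delta01 : 0 < delta <= 1.
Hypothesis B_le : forall f g : V -> R,
  \sum_u \sum_v B u v * (f u * g v) <=
  delta / 2 * (\sum_u d u * f u ^+ 2 + \sum_v d v * g v ^+ 2).

Let N (p : R) (x : V -> R) := \sum_u d u * `|x u| `^ p.

Let N_ge0 p x : 0 <= N p x.
Proof. by apply: sumr_ge0 => u _; rewrite mulr_ge0 ?rowsum_ge0 ?powR_ge0. Qed.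

Let indE (b : bool) (y z : R) : y * (z * b%:R) ^+ 2 = y * z ^+ 2 * b%:R.
Proof. by case: b; rewrite /= ?mulr1// !mulr0 expr0n/= mulr0. Qed.

(** Every layer of the kernel is the quadratic form of A at the truncation
    f = x 1_(t < |x|^(p-2)); its rank-one part is a square, and the rest is
    controlled by the gap. *)
Lemma min_kernel_ge (p : R) (x : V -> R) : 2 <= p ->
  - (delta * N p x) <= \sum_u \sum_v A u v * (x u * x v) *
     Num.min (`|x u| `^ (p - 2)) (`|x v| `^ (p - 2)).
Proof.
move=> p2.
have := @layer_cake_min R V (fun u v => A u v * (x u * x v))
  (fun u => delta / 2 * (d u * x u ^+ 2)) (fun u => delta / 2 * (d u * x u ^+ 2))
  (fun u => `|x u| `^ (p - 2)) (fun u => `|x u| `^ (p - 2)).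
move=> /(_ (fun u => powR_ge0 _ _) (fun u => powR_ge0 _ _)) L.
apply: le_trans (L _) => {L}.
  rewrite lerN2 -big_split/= mulr_sumr le_eqVlt; apply/orP; left; apply/eqP.
  by apply: eq_bigr => u _; rewrite -(@sqr_mul_powR R (x u) p)//; lra.
move=> t t0; pose f u := x u * (t < `|x u| `^ (p - 2))%R%:R.
have -> : \sum_u \sum_v A u v * (x u * x v) * ((t < `|x u| `^ (p - 2))%R%:R *
    (t < `|x v| `^ (p - 2))%R%:R) = \sum_u \sum_v A u v * (f u * f v).
  by apply: eq_bigr => u _; apply: eq_bigr => v _; rewrite /f; ring.
rewrite centered_adj_sum.
have S : 0 <= (\sum_u d u * f u) * (\sum_v d v * f v) / vol.
  by rewrite divr_ge0// -?expr2 ?sqr_ge0// ltW.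
have := B_le f (fun u => - f u).
have -> : \sum_u \sum_v B u v * (f u * - f v) = - \sum_u \sum_v B u v * (f u * f v).
  rewrite -sumrN; apply: eq_bigr => u _; rewrite -sumrN; apply: eq_bigr => v _; ring.
under [X in _ <= _ * (_ + X)]eq_bigr do rewrite sqrrN.
have -> : \sum_u delta / 2 * (d u * x u ^+ 2) * (t < `|x u| `^ (p - 2))%R%:R =
    delta / 2 * \sum_u d u * f u ^+ 2.
  by rewrite mulr_sumr; apply: eq_bigr => u _; rewrite /f indE; ring.
lra.
Qed.

(** Interpolation between L^2 and L^oo.  The balance condition replaces A by
    B.  In {x_u}^(p-1) x_v = x_u x_v |x_u|^(p-2), cut the factor |x_u|^(p-2) off
    at (|x_v| / eta)^(p-2).  The truncated kernel is a superposition of pairs of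
    layers, each bounded by the gap, for a total of delta eta^(2-p); the
    remainder lives on |x_v| <= eta |x_u| and is bounded by the row sums of |B|,
    for a total of 2 eta.  The choice eta = delta^(1/(p-1)) balances the two. *)
Lemma spow_bilinear_le (p : R) (x : V -> R) : 2 <= p -> \sum_u d u * spow (x u) (p - 1) = 0 ->
  \sum_u \sum_v A u v * (spow (x u) (p - 1) * x v) <=
  3 * delta `^ (1 / (p - 1)) * N p x.
Proof.
move=> p2 x_bal; have [d0 d1] := andP delta01.
rewrite centered_adj_sum x_bal mul0r mul0r addr0.
pose r := p - 2; have r0 : 0 <= r by rewrite /r; lra.
pose eta := delta `^ (1 / (p - 1)).
have eta0 : 0 < eta by rewrite powR_gt0.
(* the value of eta for which the two error terms agree *)
have etar : delta = eta * eta `^ r.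
  rewrite -[X in X * _]powRr1 ?(ltW eta0)// -powRD; last by rewrite (gt_eqF eta0) implybT.
  rewrite -powRrM (_ : 1 / (p - 1) * (1 + r) = 1) ?powRr1 ?ltW//.
  rewrite /r; field; rewrite gt_eqF//; lra.
have eta1 : eta <= 1.
  by rewrite /eta -[leRHS](powRr0 delta) ger_powR ?delta01// divr_ge0//; lra.
pose h u := `|x u| `^ r; pose k u := (eta^-1 * `|x u|) `^ r.
have kE u : k u = (eta `^ r)^-1 * `|x u| `^ r.
  by rewrite /k powRM ?invr_ge0 ?(ltW eta0)// -(powR_inv1 (ltW eta0)) -powRrM mulN1r powRN.
have spE u : spow (x u) (p - 1) = x u * h u.
  by rewrite spowE; [rewrite /h /r; congr (_ * _ `^ _); ring|lra].
have -> : \sum_u \sum_v B u v * (spow (x u) (p - 1) * x v) =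
   \sum_u \sum_v B u v * (x u * x v) * Num.min (h u) (k v) +
   \sum_u \sum_v B u v * (x u * x v) * (h u - Num.min (h u) (k v)).
  rewrite -big_split/=; apply: eq_bigr => u _.
  rewrite -big_split/=; apply: eq_bigr => v _; rewrite spE; ring.
have part1 : \sum_u \sum_v B u v * (x u * x v) * Num.min (h u) (k v) <= eta * N p x.
  have := @layer_cake_min R V (fun u v => - B u v * (x u * x v))
    (fun u => delta / 2 * (d u * x u ^+ 2)) (fun u => delta / 2 * (d u * x u ^+ 2)) h k.
  move=> /(_ (fun u => powR_ge0 _ _) (fun u => powR_ge0 _ _)) L.
  have {}L := L _; lapply L => {L}; last first.
    move=> t t0; pose f u := x u * (t < h u)%R%:R; pose g u := x u * (t < k u)%R%:R.
    have -> : \sum_u \sum_v - B u v * (x u * x v) * ((t < h u)%R%:R *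
        (t < k v)%R%:R) = - \sum_u \sum_v B u v * (f u * g v).
      rewrite -sumrN; apply: eq_bigr => u _; rewrite -sumrN; apply: eq_bigr => v _.
      by rewrite /f /g; ring.
    rewrite lerN2; apply: le_trans (B_le f g) _.
    under eq_bigr do rewrite /f indE.
    under [X in _ * (_ + X)]eq_bigr do rewrite /g indE.
    rewrite mulrDr !mulr_sumr -!big_split/= le_eqVlt; apply/orP; left; apply/eqP.
    apply: eq_bigr => u _; ring.
  have -> : \sum_u \sum_v - B u v * (x u * x v) * Num.min (h u) (k v) =
     - \sum_u \sum_v B u v * (x u * x v) * Num.min (h u) (k v).
    by rewrite -sumrN; apply: eq_bigr => u _; rewrite -sumrN; apply: eq_bigr => v _; ring.
  rewrite lerN2 => /le_trans; apply.
  have e0 : 0 < eta `^ r by rewrite powR_gt0.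
  have e1 : eta `^ r <= 1.
    by rewrite -[leRHS](powRr0 eta) ger_powR// eta0.
  have -> : \sum_u delta / 2 * (d u * x u ^+ 2) * h u = delta / 2 * N p x.
    rewrite mulr_sumr; apply: eq_bigr => u _.
    by rewrite -(@sqr_mul_powR R (x u) p)// /h /r; ring.
  have -> : \sum_v delta / 2 * (d v * x v ^+ 2) * k v = eta / 2 * N p x.
    rewrite mulr_sumr; apply: eq_bigr => u _.
    rewrite kE -(@sqr_mul_powR R (x u) p)// etar /r; field; rewrite gt_eqF//.
  have : delta <= eta by rewrite etar ler_piMr// ltW.
  move=> /(ler_wpM2r (N_ge0 p x)) ?; lra.
have part2 : \sum_u \sum_v B u v * (x u * x v) * (h u - Num.min (h u) (k v)) <= 2 * eta * N p x.
  rewrite /N mulr_sumr; apply: ler_sum => u _.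
  apply: (@le_trans _ _ (\sum_v `|B u v| * (`|x u| `^ p * eta))); last first.
    rewrite -mulr_suml; have := centered_adj_rowsum u.
    move=> /(ler_wpM2r (mulr_ge0 (powR_ge0 `|x u| p) (ltW eta0))) /le_trans; apply.
    by rewrite le_eqVlt; apply/orP; left; apply/eqP; ring.
  apply: ler_sum => v _; rewrite -mulrA.
  apply: le_trans (ler_norm _) _; rewrite normrM ler_wpM2l//.
  have [hk|kh] := leP (h u) (k v).
    by rewrite subrr mulr0 normr0 mulr_ge0 ?powR_ge0// ltW.
  have k0 : 0 <= k v by rewrite powR_ge0.
  have xuv : `|x v| <= eta * `|x u|.
    rewrite leNgt; apply/negP => lt; move: kh; rewrite ltNge => /negP; apply.
    rewrite ge0_ler_powR ?nnegrE ?mulr_ge0 ?invr_ge0 ?(ltW eta0)//.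
    by rewrite -(ler_pM2l eta0) mulrA divff ?gt_eqF// mul1r ltW.
  rewrite !normrM (@ger0_norm _ (h u - k v)); last by rewrite subr_ge0 ltW.
  rewrite -(@sqr_mul_powR R (x u) p)// -/r -/(h u) -(@real_normK _ (x u)) ?num_real// expr2.
  have -> : `|x u| * `|x u| * h u * eta = `|x u| * (eta * `|x u|) * h u by ring.
  apply: ler_pM; rewrite ?mulr_ge0 ?subr_ge0 ?(ltW kh)//.
    by rewrite ler_wpM2l.
  by rewrite gerBl.
rewrite -/eta; lra.
Qed.

Lemma energy_ge (p : R) (x : V -> R) : 2 <= p -> \sum_u d u * spow (x u) (p - 1) = 0 ->
  (1 - 4 * p * delta `^ (1 / (p - 1))) * N p x <=
  2^-1 * \sum_u \sum_v A u v * `|x u - x v| `^ p.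
Proof.
move=> p2 x_bal; have L1 := min_kernel_ge x p2; have L2 := spow_bilinear_le p2 x_bal.
have [d0 d1] := andP delta01.
have dd : delta <= delta `^ (1 / (p - 1)).
  rewrite -{1}(powRr1 (ltW d0)) ger_powR ?delta01//.
  by rewrite div1r invf_le1; lra.
have P : \sum_u \sum_v A u v * (`|x u| `^ p + `|x v| `^ p
    - p * (spow (x u) (p - 1) * x v + spow (x v) (p - 1) * x u)
    + p * (x u * x v * Num.min (`|x u| `^ (p - 2)) (`|x v| `^ (p - 2)))) <=
    \sum_u \sum_v A u v * `|x u - x v| `^ p.
  by apply: ler_sum => u _; apply: ler_sum => v _; rewrite ler_wpM2l// powR_dist_ge.
have swap (F : V -> V -> R) : \sum_u \sum_v A u v * F v u = \sum_u \sum_v A u v * F u v.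
  by rewrite exchange_big/=; apply: eq_bigr => u _; apply: eq_bigr => v _; rewrite A_sym.
have N1 : \sum_u \sum_v A u v * `|x u| `^ p = N p x.
  by apply: eq_bigr => u _; rewrite dE -mulr_suml.
have N2 : \sum_u \sum_v A u v * `|x v| `^ p = N p x.
  by rewrite -N1 (swap (fun u v => `|x u| `^ p)).
have Y2 := swap (fun u v => spow (x u) (p - 1) * x v).
move: P; have -> : \sum_u \sum_v A u v * (`|x u| `^ p + `|x v| `^ p
    - p * (spow (x u) (p - 1) * x v + spow (x v) (p - 1) * x u)
    + p * (x u * x v * Num.min (`|x u| `^ (p - 2)) (`|x v| `^ (p - 2)))) =
  \sum_u \sum_v A u v * `|x u| `^ p + \sum_u \sum_v A u v * `|x v| `^ p
  - p * (\sum_u \sum_v A u v * (spow (x u) (p - 1) * x v)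
     + \sum_u \sum_v A u v * (spow (x v) (p - 1) * x u))
  + p * \sum_u \sum_v A u v * (x u * x v) *
     Num.min (`|x u| `^ (p - 2)) (`|x v| `^ (p - 2)).
  rewrite -!big_split/= !mulr_sumr -sumrN -!big_split/=; apply: eq_bigr => u _.
  rewrite -!big_split/= !mulr_sumr -sumrN -!big_split/=; apply: eq_bigr => v _.
  by ring.
rewrite Y2 N1 N2.
move: (\sum_u \sum_v _) L2 => Y L2.
move: (\sum_u \sum_v _) L1 => M L1.
move: (\sum_u \sum_v _) => E P.
have p0 : 0 <= p by lra.
have L1' := ler_wpM2l p0 L1; have L2' := ler_wpM2l p0 L2.
have L3 := ler_wpM2l p0 (ler_wpM2r (N_ge0 p x) dd).
have L4 : 0 <= p * (delta `^ (1 / (p - 1)) * N p x) by rewrite !mulr_ge0 ?powR_ge0.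
lra.
Qed.

End energy.

(** * The Rayleigh quotient of the p-Laplacian *)

Section continuity.
Variable R : realType.

(** For r < 1 the function is not differentiable at 0, where continuity is
    checked directly. *)
Lemma continuous_norm_powR (r : R) : 0 <= r -> continuous (fun t : R => `|t| `^ r).
Proof.
rewrite le_eqVlt => /predU1P[<-|r0] t.
  under [X in continuous_at _ X]funext do rewrite powRr0.
  exact: cvg_cst.
have [->|t0] := eqVneq t 0.
  rewrite /continuous_at normr0 powR0 ?gt_eqF//.
  apply/cvgrPdist_lt => e e0.
  near=> y; rewrite sub0r normrN ger0_norm ?powR_ge0//.
  have -> : e = (e `^ r^-1) `^ r by rewrite -powRrM mulVf ?gt_eqF// powRr1 ?ltW.
  rewrite gt0_ltr_powR ?nnegrE ?powR_ge0//.
  near: y; apply/nbhs_ballP; exists (e `^ r^-1); rewrite /= ?powR_gt0//.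
  by move=> y; rewrite /ball/= sub0r normrN.
apply: (@continuous_comp _ _ _ (fun t : R => `|t|) (fun t => t `^ r)).
  exact: norm_continuous.
apply: differentiable_continuous; apply/derivable1_diffP.
by apply: derivable_powR; rewrite in_itv/= andbT normr_gt0.
Unshelve. all: by end_near. Qed.

Lemma continuous_spow (q : R) : 1 <= q -> continuous (fun t : R => spow t q).
Proof.
move=> q1 t; have -> : (fun t : R => spow t q) = (fun t => t * `|t| `^ (q - 1)).
  by apply/funext => s; rewrite spowE.
by apply: cvgM; [exact: cvg_id|apply: continuous_norm_powR; lra].
Qed.

Lemma continuous_mul (T : topologicalType) (f g : T -> R) :
  continuous f -> continuous g -> continuous (fun t => f t * g t).
Proof. by move=> cf cg t; apply: cvgM; [exact: cf|exact: cg]. Qed.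

Lemma continuous_sub (T : topologicalType) (f g : T -> R) :
  continuous f -> continuous g -> continuous (fun t => f t - g t).
Proof. by move=> cf cg t; apply: cvgB; [exact: cf|exact: cg]. Qed.

Lemma continuous_sum (T : topologicalType) (I : Type) (s : seq I) (F : I -> T -> R) :
  (forall i, continuous (F i)) -> continuous (fun t => \sum_(i <- s) F i t).
Proof.
move=> cF t; elim: s => [|i s IH].
  under [X in continuous_at _ X]funext do rewrite big_nil.
  exact: cvg_cst.
under [X in continuous_at _ X]funext do rewrite big_cons.
by apply: cvgD => //; apply: cF.
Qed.

Lemma spow_ge0 (t q : R) : 0 <= t -> 0 <= spow t q.
Proof. by move=> t0; rewrite /spow mulr_ge0 ?powR_ge0// sgr_ge0. Qed.

Lemma spow_eq0 (t q : R) : spow t q = 0 -> t = 0.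
Proof.
move=> /eqP; rewrite /spow mulf_eq0 sgr_eq0 => /orP[/eqP//|].
by move=> /eqP/powR_eq0_eq0/normr0_eq0.
Qed.

Lemma spowZ (c t q : R) : 0 < c -> spow (c * t) q = c `^ q * spow t q.
Proof.
by move=> c0; rewrite /spow sgrM gtr0_sg// mul1r normrM powRM// gtr0_norm// mulrCA.
Qed.

End continuity.

Section rayleigh.
Variables (R : realType) (V : finType) (A : V -> V -> R) (p : R).

Definition wdeg u := \sum_v A u v.
Definition penergy (x : V -> R) := 2^-1 * \sum_u \sum_v A u v * `|x u - x v| `^ p.
Definition pmass (x : V -> R) := \sum_u wdeg u * `|x u| `^ p.
Definition pbalance (x : V -> R) := \sum_u wdeg u * spow (x u) (p - 1).

Hypothesis A_ge0 : forall u v, 0 <= A u v.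
Hypothesis A_sym : forall u v, A u v = A v u.
Hypothesis p_ge2 : 2 <= p.

Lemma sum_by_parts (h : V -> R) (S : V -> V -> R) :
  (forall u v, S v u = - S u v) ->
  \sum_u h u * \sum_v A u v * S u v =
  2^-1 * \sum_u \sum_v A u v * ((h u - h v) * S u v).
Proof.
move=> S_anti.
have E1 : \sum_u h u * \sum_v A u v * S u v = \sum_u \sum_v A u v * (h u * S u v).
  by apply: eq_bigr => u _; rewrite mulr_sumr; apply: eq_bigr => v _; ring.
have E2 : \sum_u \sum_v A u v * (h u * S u v) = - \sum_u \sum_v A u v * (h v * S u v).
  rewrite exchange_big/= -sumrN; apply: eq_bigr => u _.
  by rewrite -sumrN; apply: eq_bigr => v _; rewrite A_sym S_anti; ring.
have -> : \sum_u \sum_v A u v * ((h u - h v) * S u v) =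
  \sum_u \sum_v A u v * (h u * S u v) - \sum_u \sum_v A u v * (h v * S u v).
  rewrite -sumrN -big_split/=; apply: eq_bigr => u _.
  by rewrite -sumrN -big_split/=; apply: eq_bigr => v _; ring.
lra.
Qed.

Lemma penergy_ge0 x : 0 <= penergy x.
Proof.
rewrite mulr_ge0// sumr_ge0// => u _; rewrite sumr_ge0// => v _.
by rewrite mulr_ge0// powR_ge0.
Qed.

Lemma wdeg_ge0 u : 0 <= wdeg u. Proof. by rewrite sumr_ge0. Qed.

Lemma pmass_ge0 x : 0 <= pmass x.
Proof. by rewrite sumr_ge0// => u _; rewrite mulr_ge0 ?powR_ge0 ?wdeg_ge0. Qed.

Lemma penergyZ c x : 0 < c -> penergy (fun u => c * x u) = c `^ p * penergy x.
Proof.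
move=> c0; rewrite /penergy mulrCA; congr (_ * _); rewrite mulr_sumr.
apply: eq_bigr => u _; rewrite mulr_sumr; apply: eq_bigr => v _.
by rewrite -mulrBr normrM powRM// gtr0_norm// mulrCA.
Qed.

Lemma pmassZ c x : 0 < c -> pmass (fun u => c * x u) = c `^ p * pmass x.
Proof.
move=> c0; rewrite /pmass mulr_sumr; apply: eq_bigr => u _.
by rewrite normrM powRM// gtr0_norm// mulrCA.
Qed.

Lemma pbalanceZ c x : 0 < c ->
  pbalance (fun u => c * x u) = c `^ (p - 1) * pbalance x.
Proof.
move=> c0; rewrite /pbalance mulr_sumr; apply: eq_bigr => u _.
by rewrite spowZ// mulrCA.
Qed.

Lemma penergyB c x : penergy (fun u => x u - c) = penergy x.
Proof.
rewrite /penergy; congr (_ * _); apply: eq_bigr => u _; apply: eq_bigr => v _.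
by congr (_ * `|_| `^ _); ring.
Qed.

(** The balance of x - c is continuous in c and changes sign between the two
    constants -M and M bounding all the entries of x. *)
Lemma exists_pbalance x : exists c, pbalance (fun u => x u - c) = 0.
Proof.
have p2 := p_ge2.
pose f c := pbalance (fun u => x u - c).
have cf : continuous f.
  apply: continuous_sum => u; apply: continuous_mul; first exact: cst_continuous.
  move=> t; apply: (@continuous_comp _ _ _ (fun c : R => x u - c) (fun t => spow t (p - 1))).
    by apply: continuous_sub => ?; [exact: cvg_cst|exact: cvg_id].
  by apply: continuous_spow; lra.
pose M := \sum_u `|x u|.
have M0 : 0 <= M by rewrite sumr_ge0.
have xM u : `|x u| <= M by rewrite /M (bigD1 u)//= lerDl sumr_ge0.
have fl : 0 <= f (- M).
  rewrite sumr_ge0// => u _; rewrite mulr_ge0 ?wdeg_ge0// spow_ge0//.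
  by have := xM u; rewrite ler_norml => /andP[]; lra.
have fr : f M <= 0.
  rewrite -oppr_ge0 -sumrN sumr_ge0// => u _.
  rewrite -mulrN -spowN mulr_ge0 ?wdeg_ge0// spow_ge0//.
  by have := xM u; rewrite ler_norml => /andP[]; lra.
have [|||c _ fc] := @IVT R f (- M) M 0.
- lra.
- exact: continuous_subspaceT.
- by rewrite ge_min fr orbT le_max fl.
by exists c.
Qed.

Hypothesis wdeg_gt0 : forall u, 0 < wdeg u.

Lemma pmass_gt0 x u : x u != 0 -> 0 < pmass x.
Proof.
move=> xu; rewrite /pmass (bigD1 u)//= ltr_pwDl//.
  by rewrite mulr_gt0// powR_gt0// normr_gt0.
by rewrite sumr_ge0// => v _; rewrite mulr_ge0 ?powR_ge0 ?wdeg_ge0.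
Qed.

Lemma pmass_nonconstant x c : nonconstant x -> 0 < pmass (fun u => x u - c).
Proof.
move=> [u [v xuv]]; have [E|xu] := eqVneq (x u) c; last first.
  by apply: (@pmass_gt0 _ u); rewrite subr_eq0.
by apply: (@pmass_gt0 _ v); rewrite subr_eq0 -E eq_sym.
Qed.

(** Euler-Lagrange equation at a balanced minimizer of the Rayleigh quotient,
    in direction of the indicator h of u0.  Re-balancing x + t h by a constant c
    leaves the energy unchanged, and convexity bounds the mass of the shifted
    function from below by its linearization at x, in which c drops out because
    x is balanced.  Convexity of the energy, linearized at x + t h, bounds it
    from the other side.  Hence t (g t - penergy x * y) >= 0 for every t, where,
    up to a common factor p, g t is the derivative of the energy at x + t h and
    y that of the mass at x, both in direction h; continuity of g at 0
    concludes. *)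
Lemma minimizer_stationary x :
  (forall w, pbalance w = 0 -> penergy x * pmass w <= penergy w) ->
  pbalance x = 0 -> pmass x = 1 ->
  forall u, \sum_v A u v * spow (x u - x v) (p - 1) =
            penergy x * (wdeg u * spow (x u) (p - 1)).
Proof.
move=> x_min x_bal x_mass u0.
have p2 := p_ge2.
pose h u : R := (u == u0)%:R.
(* gradient of the energy along the edge uv at the perturbed function x + t h *)
pose S t u v := spow (x u - x v + t * (h u - h v)) (p - 1).
have S_anti t u v : S t v u = - S t u v.
  by rewrite /S -spowN; congr (spow _ _); ring.
pose g t := \sum_v A u0 v * S t u0 v.
have hsum (F : V -> R) : \sum_u h u * F u = F u0.
  rewrite (bigD1 u0)//= /h eqxx mul1r big1 ?addr0// => u /negPf ->.
  by rewrite mul0r.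
pose y := wdeg u0 * spow (x u0) (p - 1).
have key t : 0 <= t * (g t - penergy x * y).
  pose z u := x u + t * h u.
  have [c zc] := exists_pbalance z.
  have H1 := x_min _ zc; rewrite penergyB in H1.
  have H2 : pmass x + p * (t * y) <= pmass (fun u => z u - c).
    have E : pmass x + p * \sum_u wdeg u * (spow (x u) (p - 1) * (z u - c - x u)) <=
        pmass (fun u => z u - c).
      rewrite mulr_sumr -big_split/=; apply: ler_sum => u _.
      rewrite mulrCA -mulrDr ler_wpM2l ?wdeg_ge0//.
      by apply: powR_tangent; lra.
    apply: le_trans E; rewrite le_eqVlt; apply/orP; left; apply/eqP.
    congr (_ + p * _).
    have -> : \sum_u wdeg u * (spow (x u) (p - 1) * (z u - c - x u)) =
      t * (\sum_u h u * (wdeg u * spow (x u) (p - 1))) - c * pbalance x.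
      rewrite /pbalance !mulr_sumr -sumrN -big_split/=; apply: eq_bigr => u _.
      by rewrite /z; ring.
    by rewrite hsum x_bal mulr0 subr0.
  have H3 : penergy z - p * (t * g t) <= penergy x.
    have -> : t * g t = \sum_u (t * h u) * \sum_v A u v * S t u v.
      rewrite /g -(hsum (fun u => \sum_v A u v * S t u v)) mulr_sumr.
      by apply: eq_bigr => u _; rewrite mulrA.
    rewrite (@sum_by_parts _ _ (S_anti t)) /penergy mulrCA -mulrBr ler_pM2l//.
    rewrite mulr_sumr -sumrN -big_split/=; apply: ler_sum => u _.
    rewrite mulr_sumr -sumrN -big_split/=; apply: ler_sum => v _.
    have -> : A u v * `|z u - z v| `^ p - p * (A u v * ((t * h u - t * h v) * S t u v)) =
      A u v * (`|z u - z v| `^ p + p * (spow (z u - z v) (p - 1)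
        * (x u - x v - (z u - z v)))).
      have -> : S t u v = spow (z u - z v) (p - 1).
        by rewrite /S /z; congr (spow _ _); ring.
      by rewrite /z; ring.
    by rewrite ler_wpM2l//; apply: powR_tangent; lra.
  have := ler_wpM2l (penergy_ge0 x) H2; rewrite x_mass => H4.
  suff : 0 <= p * (t * (g t - penergy x * y)) by rewrite pmulr_rge0//; lra.
  lra.
have cg : continuous g.
  apply: continuous_sum => v t; apply: cvgM; first by exact: cvg_cst.
  apply: (@continuous_comp _ _ _ (fun t : R => x u0 - x v + t * (h u0 - h v))
    (fun t => spow t (p - 1))).
    apply: cvgD; first by exact: cvg_cst.
    by apply: cvgM; [exact: cvg_id|exact: cvg_cst].
  by apply: continuous_spow; lra.
have -> : \sum_v A u0 v * spow (x u0 - x v) (p - 1) = g 0.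
  by apply: eq_bigr => v _; rewrite /S mul0r addr0.
apply/eqP; rewrite -/y -subr_eq0 -normr_le0 leNgt; apply/negP => D0.
have /cvgrPdist_lt/(_ _ D0) := cg 0.
move=> /nbhs_ballP[e /= e0 H].
pose t : R := e / 2.
have t0 : 0 < t by rewrite divr_gt0.
have ball t' : `|t'| = t -> `|g 0 - g t'| < `|g 0 - penergy x * y|.
  by move=> tt; apply: H; rewrite /ball/= sub0r normrN tt /t; lra.
have K1 := key t; have K2 := key (- t).
rewrite pmulr_rge0// in K1; rewrite mulNr oppr_ge0 pmulr_rle0// in K2.
have := ball t (gtr0_norm t0); have := ball (- t); rewrite normrN gtr0_norm// => /(_ erefl).
set D := penergy x * y in K1 K2 *.
have [q|q] := leP 0 (g 0 - D).
  rewrite !(ger0_norm q) !ltr_norml => /andP[? ?] /andP[? ?]; lra.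
rewrite !(ltr0_norm q) !ltr_norml => /andP[? ?] /andP[? ?]; lra.
Qed.

End rayleigh.

(** * Existence of the first eigenvalue *)

Section existence.
Variables (R : realType) (m : nat) (A : 'I_m -> 'I_m -> R) (p : R).
Hypothesis m_gt1 : (1 < m)%N.
Hypothesis A_ge0 : forall u v, 0 <= A u v.
Hypothesis p_ge2 : 2 <= p.
Hypothesis wdeg_ge1 : forall u, 1 <= wdeg A u.

Let wdeg_gt0 u : 0 < wdeg A u.
Proof. exact: lt_le_trans (wdeg_ge1 u). Qed.

(** By homogeneity the Rayleigh quotient may be minimized over the balanced
    functions of mass 1.  As all degrees are at least 1 these have entries in
    [-1, 1], so they form a compact set. *)
Lemma exists_minimizer : exists x : 'I_m -> R,
  [/\ pbalance A p x = 0, pmass A p x = 1 &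
   forall w, pbalance A p w = 0 -> penergy A p x * pmass A p w <= penergy A p w].
Proof.
have p2 := p_ge2.
pose K : set 'rV[R]_m := ([set v | (forall i, `[-1, 1] (v ord0 i))] `&`
  [set v | pmass A p (v ord0) = 1%R] `&` [set v | pbalance A p (v ord0) = 0%R])%classic.
have cM : continuous (fun v : 'rV[R]_m => pmass A p (v ord0)).
  apply: continuous_sum => u; apply: continuous_mul; first exact: cst_continuous.
  move=> v; apply: (@continuous_comp _ _ _ (fun v : 'rV[R]_m => v ord0 u)
    (fun t => `|t| `^ p)); first exact: coord_continuous.
  by apply: continuous_norm_powR; lra.
have cB : continuous (fun v : 'rV[R]_m => pbalance A p (v ord0)).
  apply: continuous_sum => u; apply: continuous_mul; first exact: cst_continuous.
  move=> v; apply: (@continuous_comp _ _ _ (fun v : 'rV[R]_m => v ord0 u)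
    (fun t => spow t (p - 1))); first exact: coord_continuous.
  by apply: continuous_spow; lra.
have cE : continuous (fun v : 'rV[R]_m => penergy A p (v ord0)).
  apply: continuous_mul; first exact: cst_continuous.
  apply: continuous_sum => u; apply: continuous_sum => w.
  apply: continuous_mul; first exact: cst_continuous.
  move=> v; apply: (@continuous_comp _ _ _ (fun v : 'rV[R]_m => v ord0 u - v ord0 w)
     (fun t => `|t| `^ p)).
    by apply: continuous_sub; exact: coord_continuous.
  by apply: continuous_norm_powR; lra.
have cK : compact K.
  apply: compact_closedI; last first.
    apply: (@preimage_closed _ _ (fun v : 'rV[R]_m => pbalance A p (v ord0)) [set 0%R]%classic).
      by move=> v _; apply: cB.
    exact: closed_eq.
  apply: compact_closedI; last first.
    apply: (@preimage_closed _ _ (fun v : 'rV[R]_m => pmass A p (v ord0)) [set 1%R]%classic).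
      by move=> v _; apply: cM.
    exact: closed_eq.
  apply: (@rV_compact R m (fun=> `[-1, 1]%classic)) => i; exact: segment_compact.
have norm w : pbalance A p w = 0 -> 0 < pmass A p w ->
  exists2 v : 'rV[R]_m, K v & penergy A p (v ord0) * pmass A p w = penergy A p w.
  move=> wB wM.
  pose t := pmass A p w `^ (- p^-1).
  have t0 : 0 < t by rewrite powR_gt0.
  have tp : t `^ p = (pmass A p w)^-1.
    by rewrite /t -powRrM mulNr mulVf ?gt_eqF ?powR_inv1 ?ltW//; lra.
  have rowE : (\row_i (t * w i)) ord0 = (fun i => t * w i).
    by apply/funext => i; rewrite mxE.
  exists (\row_i (t * w i)); last first.
    by rewrite rowE penergyZ// tp mulrAC mulVf ?gt_eqF// mul1r.
  have M1 : pmass A p (fun i => t * w i) = 1.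
    by rewrite pmassZ// tp mulVf// gt_eqF.
  split; [split=> [i|]|]; rewrite /= rowE//; last by rewrite pbalanceZ// wB mulr0.
  rewrite in_itv/= -ler_norml leNgt; apply/negP => lt1.
  have : 1 < `|t * w i| `^ p.
    have := @gt0_ltr_powR R p ltac:(lra) 1 `|t * w i|; rewrite powR1; apply; rewrite ?nnegrE//.
  apply/negP; rewrite -leNgt -M1 /pmass (bigD1 i)//=.
  apply: (@le_trans _ _ (wdeg A i * `|t * w i| `^ p)).
    by rewrite ler_peMl// powR_ge0.
  by rewrite lerDl sumr_ge0// => j _; rewrite mulr_ge0 ?powR_ge0// ltW.
pose i0 : 'I_m := Ordinal (ltnW m_gt1); pose i1 : 'I_m := Ordinal m_gt1.
pose z (i : 'I_m) : R := (i == i0)%:R.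
have [c zc] := exists_pbalance A_ge0 p_ge2 z.
have zM : 0 < pmass A p (fun u => z u - c).
  apply: pmass_nonconstant => //; exists i0, i1.
  by rewrite /z eqxx -(inj_eq val_inj)/= oner_eq0.
have [v0 Kv0 _] := norm _ zc zM.
have [||v vK vmin] := @EVT_min_rV R m (fun v => penergy A p (v ord0)) K _ cK.
- by exists v0.
- exact: continuous_subspaceT.
move: vK; rewrite inE /K/= => -[[_ vM] vB].
exists (v ord0); split=> // w wB.
have := pmass_ge0 p A_ge0 w; rewrite le_eqVlt => /predU1P[<-|wM].
  by rewrite mulr0 penergy_ge0.
have [w' w'K <-] := norm _ wB wM.
by apply: ler_wpM2r; [exact: ltW|apply: vmin; rewrite inE].
Qed.

End existence.

Definition adjr (R : realType) (m : nat) (G : sgraph 'I_m) (u v : 'I_m) : R :=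
  (adj G u v)%:R.

Section graph.
Variables (R : realType) (m : nat) (G : sgraph 'I_m) (p : R).
Hypothesis p_ge2 : 2 <= p.
Hypothesis valency_gt0 : forall u, (0 < valency G u)%N.

Let A := @adjr R m G.

Lemma adjr_ge0 u v : 0 <= A u v. Proof. exact: ler0n. Qed.

Lemma adjr_sym u v : A u v = A v u.
Proof. by rewrite /A /adjr /adj finset.setUC. Qed.

Lemma wdeg_adjr u : wdeg A u = (valency G u)%:R.
Proof.
rewrite /wdeg /valency -sum1_card natr_sum [RHS]big_mkcond/=; apply: eq_bigr => v _.
by rewrite inE /A /adjr; case: adj.
Qed.

Lemma plaplacianE x u : plaplacian G p x u =
  (wdeg A u)^-1 * \sum_v A u v * spow (x u - x v) (p - 1).
Proof.
rewrite /plaplacian wdeg_adjr; congr (_ * _); rewrite [LHS]big_mkcond/=.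
by apply: eq_bigr => v _; rewrite /A /adjr; case: adj; rewrite ?mul1r ?mul0r.
Qed.

Let wdeg_ge1 u : 1 <= wdeg A u.
Proof. by rewrite wdeg_adjr ler1n. Qed.

Let wdeg_gt0 u : 0 < wdeg A u.
Proof. exact: lt_le_trans (wdeg_ge1 u). Qed.

(** Summation by parts of the eigenvalue equation against 1 shows that x is
    balanced when l <> 0, and against x that l is its Rayleigh quotient.  When
    l = 0 the energy of x vanishes, so c <= 0 follows by applying the hypothesis
    to the balanced translate of x. *)
Lemma nonconstant_eigenvalue_ge (c l : R) :
  (forall w, pbalance A p w = 0 -> c * pmass A p w <= penergy A p w) ->
  nonconstant_eigenvalue G p l -> c <= l.
Proof.
move=> cE [x [[_ xE] x_nc]]; have p2 := p_ge2.
have eqn u : \sum_v A u v * spow (x u - x v) (p - 1) =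
    l * (wdeg A u * spow (x u) (p - 1)).
  have := xE u; rewrite plaplacianE => /(congr1 (fun t => wdeg A u * t)).
  by rewrite mulVKf ?gt_eqF// => ->; ring.
have S_anti u v : spow (x v - x u) (p - 1) = - spow (x u - x v) (p - 1).
  by rewrite -spowN opprB.
have L1 : l * pbalance A p x = 0.
  have := sum_by_parts adjr_sym (fun=> 1) S_anti.
  under eq_bigr do rewrite mul1r eqn; rewrite -mulr_sumr => ->.
  rewrite big1 ?mulr0// => u _; rewrite big1// => v _.
  by rewrite subrr mul0r mulr0.
have L2 : l * pmass A p x = penergy A p x.
  have := sum_by_parts adjr_sym x S_anti.
  under eq_bigr do rewrite eqn mulrCA.
  rewrite -mulr_sumr => E.
  have -> : pmass A p x = \sum_u x u * (wdeg A u * spow (x u) (p - 1)).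
    apply: eq_bigr => u _; rewrite mulrCA mul_spow ?subrK//; lra.
  rewrite E /penergy; congr (_ * _); apply: eq_bigr => u _; apply: eq_bigr => v _.
  by rewrite mul_spow ?subrK//; lra.
have [b xb] := exists_pbalance adjr_ge0 p_ge2 x.
have [l0|l0] := eqVneq l 0.
  have := cE _ xb; rewrite penergyB -L2 l0 mul0r.
  by rewrite pmulr_lle0// pmass_nonconstant//; exact: adjr_ge0.
have xbal : pbalance A p x = 0.
  by apply/eqP; have /eqP := L1; rewrite mulf_eq0 (negPf l0).
have := cE _ xbal; rewrite -L2 ler_pM2r//.
have := @pmass_nonconstant R _ A p adjr_ge0 wdeg_gt0 _ 0 x_nc.
by under [X in _ < pmass _ _ X]funext do rewrite subr0.
Qed.

(** The minimum of the Rayleigh quotient is a non-constant eigenvalue and a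
    lower bound for all of them, so the default value in the definition of
    [lambda1] does not occur. *)
Theorem lambda1_ge (c : R) : (1 < m)%N ->
  (forall w, pbalance A p w = 0 -> c * pmass A p w <= penergy A p w) ->
  c <= lambda1 G p.
Proof.
move=> m_gt1 cE; have p2 := p_ge2.
have [x [xB xM xmin]] := exists_minimizer m_gt1 adjr_ge0 p_ge2 wdeg_ge1.
have xst := minimizer_stationary adjr_ge0 adjr_sym p_ge2 xmin xB xM.
apply: nonconstant_eigenvalue_ge => //.
have ex : [set l | nonconstant_eigenvalue G p l /\
   forall l', nonconstant_eigenvalue G p l' -> l <= l']%classic (penergy A p x).
  split; last by move=> l'; apply: nonconstant_eigenvalue_ge.
  have xnc : nonconstant x.
    apply: contrapT => nc.
    have xc u v : x u = x v.
      by apply: contrapT => /eqP xuv; apply: nc; exists u, v.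
    pose i0 : 'I_m := Ordinal (ltnW m_gt1).
    have : pbalance A p x = (\sum_u wdeg A u) * spow (x i0) (p - 1).
      by rewrite mulr_suml; apply: eq_bigr => u _; rewrite (xc u i0).
    rewrite xB => /esym/eqP; rewrite mulf_eq0 => /orP[|/eqP/spow_eq0 x0].
      rewrite gt_eqF// (bigD1 i0)//= ltr_pwDl// sumr_ge0// => u _; exact: ltW.
    have := oner_neq0 R; rewrite -xM /pmass big1 ?eqxx// => u _.
    by rewrite (xc u i0) x0 normr0 powR0 ?mulr0// gt_eqF//; lra.
  exists x; split=> //; split.
    have [u [v xuv]] := xnc.
    have [xu|] := eqVneq (x u) 0; last by exists u.
    by exists v; rewrite -xu eq_sym.
  move=> u; rewrite plaplacianE xst; field; rewrite gt_eqF//.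
by have [] := xgetPex 0 (ex_intro _ _ ex).
Qed.

End graph.

(** * Bilinear forms and discrepancy *)

Section discrepancy.
Variables (R : realType) (V : finType).

(** A bilinear form on a product of boxes is maximal at a vertex, that is, at a
    pair of multiples of indicator functions of sets. *)
Lemma box_bilinear_le (M : V -> V -> R) (f g : V -> R) (a b c : R) (L L' : {set V}) :
  0 <= a -> 0 <= b ->
  (forall u, 0 <= f u) -> (forall u, f u <= a * (u \in L)%:R) ->
  (forall v, 0 <= g v) -> (forall v, g v <= b * (v \in L')%:R) ->
  (forall S T : {set V}, S \subset L -> T \subset L' ->
     \sum_(u in S) \sum_(v in T) M u v <= c) ->
  \sum_u \sum_v M u v * (f u * g v) <= a * b * c.
Proof.
move=> a0 b0 f0 fa g0 gb H.
have one (h r : V -> R) (e : R) (D : {set V}) : 0 <= e ->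
    (forall u, 0 <= h u) -> (forall u, h u <= e * (u \in D)%:R) ->
    \sum_u h u * r u <= e * \sum_(u in [set u in D | 0 < r u]) r u.
  move=> e0 h0 he; rewrite [X in e * X]big_mkcond/= mulr_sumr.
  apply: ler_sum => u _; rewrite inE; have := he u; have := h0 u.
  case: (u \in D) => /=; last first.
    rewrite mulr0n mulr0 => ? ?; have -> : h u = 0 by lra.
    by rewrite mul0r ?mulr0.
  rewrite mulr1 => hu0 hue; case: ltP => ru; last by rewrite ?mulr0 mulr_ge0_le0.
  by rewrite ler_pM2r.
pose S := [set u in L | 0 < \sum_v M u v * g v].
pose T := [set v in L' | 0 < \sum_(u in S) M u v].
have -> : \sum_u \sum_v M u v * (f u * g v) = \sum_u f u * \sum_v M u v * g v.
  by apply: eq_bigr => u _; rewrite mulr_sumr; apply: eq_bigr => v _; ring.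
apply: le_trans (one f _ a L a0 f0 fa) _; rewrite -/S -mulrA ler_wpM2l//.
have -> : \sum_(u in S) \sum_v M u v * g v = \sum_v g v * \sum_(u in S) M u v.
  rewrite exchange_big/=; apply: eq_bigr => v _.
  by rewrite mulr_sumr; apply: eq_bigr => u _; ring.
apply: le_trans (one g _ b L' b0 g0 gb) _; rewrite -/T ler_wpM2l//.
rewrite exchange_big/= H//; apply/fintype.subsetP => u; rewrite inE => /andP[]//.
Qed.

Definition dyadic_level (x : R) : nat := trunc_log 2 (Num.truncn x).

Lemma dyadic_level_itv (x : R) : 1 <= x ->
  2 ^+ dyadic_level x <= x < 2 ^+ (dyadic_level x).+1.
Proof.
move=> x1; have x0 : 0 <= x by lra.
have /andP[l r] := truncn_itv x0.
have t0 : (0 < Num.truncn x)%N by rewrite truncn_gt0.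
have /andP[l' r'] := trunc_log_bounds (isT : (1 < 2)%N) t0.
apply/andP; split.
  by apply: le_trans l; rewrite -natrX ler_nat.
by apply: lt_le_trans r _; rewrite -natrX ler_nat.
Qed.

Definition near_levels (k i j : nat) := (i <= j + k)%N && (j <= i + k)%N.

Lemma sum_near_levels (k N i : nat) :
  \sum_(j < N) (near_levels k i j)%:R <= (2 * k + 1)%:R :> R.
Proof.
rewrite -natr_sum ler_nat.
have -> : (\sum_(j < N) near_levels k i j = size [seq j <- iota 0 N | near_levels k i j])%N.
  rewrite size_filter -sum1_count -(big_mkord xpredT (fun j => near_levels k i j : nat)).
  by rewrite [RHS]big_mkcond/= /index_iota subn0; apply: eq_bigr => j _; case: near_levels.
rewrite -[leqRHS](size_iota (i - k)%N); apply: uniq_leq_size.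
  by rewrite filter_uniq// iota_uniq.
move=> j; rewrite mem_filter !mem_iota /near_levels => /andP[/andP[h1 h2] _].
by apply/andP; split; lia.
Qed.

Variables (M : V -> V -> R) (alpha Delta : R).
Hypothesis alpha_ge0 : 0 <= alpha.

(** Split f and g into dyadic levels.  Pairs of levels at distance at most k
    are bounded by discrepancy and the inequality of arithmetic and geometric
    means, each level meeting at most 2k+1 others.  For the remaining pairs of
    entries one is at least 2^k times the other, so the product is at most 2^-k
    times the square of the larger and the row sums of |M| suffice.  Bounding
    positive entries away from 0 keeps the levels natural numbers. *)
Lemma dyadic_bilinear_le (k : nat) (f g : V -> R) :
  (forall u, \sum_v `|M u v| <= Delta) -> (forall v, \sum_u `|M u v| <= Delta) ->
  (forall S T : {set V}, \sum_(u in S) \sum_(v in T) M u v <=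
     alpha * Num.sqrt (#|S|%:R * #|T|%:R)) ->
  (forall u, f u = 0 \/ 1 <= f u) -> (forall u, g u = 0 \/ 1 <= g u) ->
  \sum_u \sum_v M u v * (f u * g v) <=
  (2 * alpha * (2 * k + 1)%:R + Delta / 2 ^+ k) *
    (\sum_u f u ^+ 2 + \sum_u g u ^+ 2).
Proof.
move=> rowD colD disc f1 g1; have al0 := alpha_ge0.
have p2 n : 0 < 2 ^+ n :> R by rewrite exprn_gt0.
have ge0 (h : V -> R) : (forall u, h u = 0 \/ 1 <= h u) -> forall u, 0 <= h u.
  by move=> h1 u; have [->|] := h1 u; lra.
have f0 := ge0 _ f1; have g0 := ge0 _ g1.
pose lf u := dyadic_level (f u); pose lg u := dyadic_level (g u).
pose nr u v := near_levels k (lf u) (lg v).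
pose N := (\max_u (maxn (lf u) (lg u))).+1.
have lfN u : (lf u < N)%N.
  by rewrite ltnS; apply: leq_trans (leq_bigmax u); rewrite leq_maxl.
have lgN u : (lg u < N)%N.
  by rewrite ltnS; apply: leq_trans (leq_bigmax u); rewrite leq_maxr.
pose part (h : V -> R) (l : V -> nat) (i : nat) u := h u * (l u == i)%:R.
have sum_part (h : V -> R) (l : V -> nat) (c : nat -> R) u : (l u < N)%N ->
    \sum_(i < N) c i * part h l i u = c (l u) * h u.
  move=> luN; rewrite (bigD1 (Ordinal luN))//= /part eqxx mulr1 big1 ?addr0//.
  move=> i; rewrite -(inj_eq val_inj)/= eq_sym => /negPf ->.
  by rewrite !mulr0.
have sum_sqr (h : V -> R) (l : V -> nat) : (forall u, (l u < N)%N) ->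
    \sum_(i < N) \sum_u part h l i u ^+ 2 = \sum_u h u ^+ 2.
  move=> lN; rewrite exchange_big/=; apply: eq_bigr => u _.
  rewrite -[RHS]mul1r -(sum_part (fun v => h v ^+ 2) l (fun=> 1) u (lN u)).
  apply: eq_bigr => i _; rewrite /part mul1r exprMn.
  by case: eqP => _; rewrite ?expr1n ?expr0n.
have level_box (h : V -> R) (i : nat) : (forall u, h u = 0 \/ 1 <= h u) ->
    let l u := dyadic_level (h u) in
    let L := [set u | (l u == i) && (h u != 0)] in
    [/\ forall u, part h l i u <= 2 ^+ i.+1 * (u \in L)%:R,
        forall u, 0 <= part h l i u &
        (2 ^+ i) ^+ 2 * #|L|%:R <= \sum_u part h l i u ^+ 2].
  move=> h1 l L; split.
  - move=> u; rewrite inE /part; case: eqP => /= [<-|]; last by rewrite !mulr0.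
    have [->|hu] := h1 u; first by rewrite mul0r eqxx mulr0.
    have -> : h u != 0 by rewrite gt_eqF//; lra.
    by have /andP[_ /ltW] := dyadic_level_itv hu; rewrite !mulr1.
  - by move=> u; rewrite mulr_ge0// ge0.
  - rewrite -sum1_card natr_sum mulr_sumr big_mkcond/=; apply: ler_sum => u _.
    rewrite inE; case: ifP => [/andP[/eqP lu hu]|_]; last exact: sqr_ge0.
    rewrite mulr1 /part lu eqxx mulr1.
    have [E|{}hu] := h1 u; first by rewrite E eqxx in hu.
    have /andP[h2 _] := dyadic_level_itv hu; rewrite -/(l u) lu in h2.
    by rewrite ler_sqr ?nnegrE ?(ltW (p2 i)) ?ge0.
have pair_le (i j : nat) : \sum_u \sum_v M u v * (part f lf i u * part g lg j v) <=
    2 * alpha * (\sum_u part f lf i u ^+ 2 + \sum_u part g lg j u ^+ 2).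
  have [fL fp fs] := level_box f i f1; have [gL gp gs] := level_box g j g1.
  set L := [set u | _] in fL fs; set L' := [set u | _] in gL gs.
  have H := @box_bilinear_le M _ _ (2 ^+ i.+1) (2 ^+ j.+1)
    (alpha * Num.sqrt (#|L|%:R * #|L'|%:R)) L L' (ltW (p2 _)) (ltW (p2 _)) fp fL gp gL.
  apply: le_trans (H _) _ => {H}.
    move=> S T SL TL; apply: le_trans (disc S T) _.
    by rewrite ler_wpM2l// ler_wsqrtr// ler_pM// ler_nat subset_leq_card.
  have amgm (x y : R) : 0 <= x -> 0 <= y -> 2 * Num.sqrt (x * y) <= x + y.
    move=> x0 y0; rewrite sqrtrM//.
    have := sqr_ge0 (Num.sqrt x - Num.sqrt y).
    by rewrite sqrrB !sqr_sqrtr//; lra.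
  have := amgm ((2 ^+ i) ^+ 2 * #|L|%:R) ((2 ^+ j) ^+ 2 * #|L'|%:R).
  rewrite !mulr_ge0 ?sqr_ge0// => /(_ isT isT).
  have -> : (2 ^+ i) ^+ 2 * #|L|%:R * ((2 ^+ j) ^+ 2 * #|L'|%:R) =
    (2 ^+ i * 2 ^+ j) ^+ 2 * (#|L|%:R * #|L'|%:R) :> R by ring.
  rewrite (sqrtrM _ (sqr_ge0 _)) sqrtr_sqr.
  rewrite (@ger0_norm _ (2 ^+ i * 2 ^+ j)) ?mulr_ge0 ?(ltW (p2 _))//.
  set s := Num.sqrt (#|L|%:R * #|L'|%:R) => am.
  have -> : 2 ^+ i.+1 * 2 ^+ j.+1 * (alpha * s) =
     2 * alpha * (2 * (2 ^+ i * 2 ^+ j * s)) by rewrite !exprS; ring.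
  by rewrite ler_wpM2l ?mulr_ge0//; lra.
have nearE : \sum_u \sum_v M u v * (f u * g v) * (nr u v)%:R =
  \sum_(i < N) \sum_(j < N) (near_levels k i j)%:R *
     \sum_u \sum_v M u v * (part f lf i u * part g lg j v).
  under [RHS]eq_bigr do under eq_bigr do rewrite mulr_sumr.
  under [RHS]eq_bigr do rewrite exchange_big/=.
  rewrite [RHS]exchange_big/=; apply: eq_bigr => u _.
  under [RHS]eq_bigr do under eq_bigr do rewrite mulr_sumr.
  under [RHS]eq_bigr do rewrite exchange_big/=.
  rewrite [RHS]exchange_big/=; apply: eq_bigr => v _.
  have -> : M u v * (f u * g v) * (nr u v)%:R =
     (M u v * (near_levels k (lf u) (lg v))%:R * g v) * f u by rewrite /nr; ring.
  rewrite -(sum_part f lf (fun i => M u v * (near_levels k i (lg v))%:R * g v) u (lfN u)).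
  apply: eq_bigr => i _.
  rewrite -(sum_part g lg (fun j => M u v * (near_levels k i j)%:R) v (lgN v)) mulr_suml.
  by apply: eq_bigr => j _; ring.
have near_le : \sum_u \sum_v M u v * (f u * g v) * (nr u v)%:R <=
   2 * alpha * (2 * k + 1)%:R * (\sum_u f u ^+ 2 + \sum_u g u ^+ 2).
  rewrite nearE -(sum_sqr f lf lfN) -(sum_sqr g lg lgN).
  pose F (i : nat) := \sum_u part f lf i u ^+ 2.
  pose G (j : nat) := \sum_u part g lg j u ^+ 2.
  have F0 i : 0 <= F i by rewrite sumr_ge0// => u _; rewrite sqr_ge0.
  have G0 i : 0 <= G i by rewrite sumr_ge0// => u _; rewrite sqr_ge0.
  apply: (@le_trans _ _ (\sum_(i < N) \sum_(j < N)
     (2 * alpha * (F i * (near_levels k i j)%:R) + 2 * alpha * (G j * (near_levels k i j)%:R)))).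
    apply: ler_sum => i _; apply: ler_sum => j _.
    have := ler_wpM2l (ler0n R (near_levels k i j)) (pair_le i j).
    by rewrite -/(F i) -/(G j); lra.
  under eq_bigr do rewrite big_split/=.
  rewrite big_split/= -/F -/G mulrDr; apply: lerD.
    rewrite mulr_sumr; apply: ler_sum => i _; rewrite -!mulr_sumr.
    rewrite -[leRHS]mulrA ler_wpM2l ?mulr_ge0//.
    by rewrite mulrC ler_wpM2r// sum_near_levels.
  rewrite exchange_big mulr_sumr; apply: ler_sum => j _.
  rewrite -!mulr_sumr -[leRHS]mulrA ler_wpM2l ?mulr_ge0//.
  rewrite mulrC ler_wpM2r//.
  under eq_bigr do rewrite /near_levels andbC.
  exact: sum_near_levels.
have far_le : \sum_u \sum_v M u v * (f u * g v) * (~~ nr u v)%:R <=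
   Delta / 2 ^+ k * (\sum_u f u ^+ 2 + \sum_u g u ^+ 2).
  have pt u v : f u * g v * (~~ nr u v)%:R <= (f u ^+ 2 + g v ^+ 2) / 2 ^+ k.
    have q0 : 0 <= (f u ^+ 2 + g v ^+ 2) / 2 ^+ k.
      by apply: divr_ge0; [rewrite addr_ge0 ?sqr_ge0|exact: ltW].
    have [fu|fu] := f1 u; first by rewrite {1}fu !mul0r.
    have [gv|gv] := g1 v; first by rewrite {1}gv mulr0 mul0r.
    case: (boolP (nr u v)) => [_|]; first by rewrite mulr0.
    rewrite mulr1 ler_pdivlMr// /nr /near_levels negb_and -!ltnNge.
    have aux (x y : R) (a b : nat) : 1 <= x -> 1 <= y -> 2 ^+ a <= x -> y < 2 ^+ b.+1 ->
        (b + k < a)%N -> x * y * 2 ^+ k <= x ^+ 2 + y ^+ 2.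
      move=> x1 y1 ax yb ba.
      have : y * 2 ^+ k <= x.
        apply: le_trans ax; apply: (@le_trans _ _ (2 ^+ (b.+1 + k))).
          by rewrite exprD ler_pM2r// ltW.
        by rewrite ler_eXn2l ?ltr1n//; lia.
      have x0 : 0 <= x by lra.
      move=> /(ler_wpM2l x0); rewrite !expr2; have := sqr_ge0 y; rewrite expr2; lra.
    have /andP[lf1 lf2] := dyadic_level_itv fu.
    have /andP[lg1 lg2] := dyadic_level_itv gv.
    case/orP => lev; first exact: (aux _ _ _ _ fu gv lf1 lg2 lev).
    by rewrite [f u * _]mulrC addrC; exact: (aux _ _ _ _ gv fu lg1 lf2 lev).
  apply: (@le_trans _ _ (\sum_u \sum_v `|M u v| * ((f u ^+ 2 + g v ^+ 2) / 2 ^+ k))).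
    apply: ler_sum => u _; apply: ler_sum => v _.
    apply: le_trans (ler_norm _) _; rewrite -mulrA normrM ler_wpM2l// ger0_norm ?pt//.
    by rewrite !mulr_ge0.
  have -> : \sum_u \sum_v `|M u v| * ((f u ^+ 2 + g v ^+ 2) / 2 ^+ k) =
    (\sum_u (\sum_v `|M u v|) * f u ^+ 2 + \sum_v (\sum_u `|M u v|) * g v ^+ 2) / 2 ^+ k.
    under [X in _ = (X + _) / _]eq_bigr do rewrite mulr_suml.
    under [X in _ = (_ + X) / _]eq_bigr do rewrite mulr_suml.
    rewrite [X in _ = (_ + X) / _]exchange_big/= -big_split/= mulr_suml.
    apply: eq_bigr => u _; rewrite -big_split/= mulr_suml.
    by apply: eq_bigr => v _; ring.
  rewrite mulrAC ler_wpM2r ?invr_ge0 ?(ltW (p2 _))// mulrDr !mulr_sumr.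
  by apply: lerD; apply: ler_sum => u _; rewrite ler_wpM2r ?sqr_ge0.
have -> : \sum_u \sum_v M u v * (f u * g v) =
  \sum_u \sum_v M u v * (f u * g v) * (nr u v)%:R +
  \sum_u \sum_v M u v * (f u * g v) * (~~ nr u v)%:R.
  rewrite -big_split/=; apply: eq_bigr => u _.
  rewrite -big_split/=; apply: eq_bigr => v _.
  by case: (nr u v) => /=; rewrite ?mulr1 ?mulr0 ?addr0 ?add0r.
lra.
Qed.

End discrepancy.

(** * Discrepancy and degrees give a spectral gap *)

Section gap.
Variables (R : realType) (V : finType).

(** The inequality is homogeneous, so f and g can be scaled until all their
    positive entries are at least 1. *)
Lemma bilinear_ge0_le (M : V -> V -> R) (alpha Delta : R) (k : nat) (f g : V -> R) :
  0 <= alpha ->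
  (forall u, \sum_v `|M u v| <= Delta) -> (forall v, \sum_u `|M u v| <= Delta) ->
  (forall S T : {set V}, \sum_(u in S) \sum_(v in T) M u v <=
     alpha * Num.sqrt (#|S|%:R * #|T|%:R)) ->
  (forall u, 0 <= f u) -> (forall u, 0 <= g u) ->
  \sum_u \sum_v M u v * (f u * g v) <=
  (2 * alpha * (2 * k + 1)%:R + Delta / 2 ^+ k) *
    (\sum_u f u ^+ 2 + \sum_u g u ^+ 2).
Proof.
move=> al0 rowD colD disc f0 g0.
(* the inverse of 0 is 0, so t exceeds the inverses of all positive entries *)
pose t := 1 + \sum_u ((f u)^-1 + (g u)^-1).
have s0 u : 0 <= (f u)^-1 + (g u)^-1 by rewrite addr_ge0 ?invr_ge0.
have t1 : 1 <= t by rewrite lerDl sumr_ge0.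
have t0 : 0 < t by lra.
have tf u : (f u)^-1 <= t /\ (g u)^-1 <= t.
  have : (f u)^-1 + (g u)^-1 <= t.
    by rewrite /t (bigD1 u)//= [leRHS]addrCA lerDl addr_ge0// sumr_ge0.
  have := f0 u; have := g0 u; rewrite -invr_ge0 => ?; rewrite -invr_ge0 => ? ?; lra.
have scale (h : V -> R) u : 0 <= h u -> (h u)^-1 <= t -> t * h u = 0 \/ 1 <= t * h u.
  rewrite le_eqVlt => /predU1P[<-|hu] ht; first by left; rewrite mulr0.
  by right; rewrite -(mulVf (lt0r_neq0 hu)) ler_pM2r.
have := @dyadic_bilinear_le R V M alpha Delta al0 k (fun u => t * f u) (fun u => t * g u)
  rowD colD disc (fun u => scale f u (f0 u) (tf u).1) (fun u => scale g u (g0 u) (tf u).2).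
have -> : \sum_u \sum_v M u v * (t * f u * (t * g v)) =
   t ^+ 2 * \sum_u \sum_v M u v * (f u * g v).
  rewrite mulr_sumr; apply: eq_bigr => u _; rewrite mulr_sumr; apply: eq_bigr => v _; ring.
have sq (h : V -> R) : \sum_u (t * h u) ^+ 2 = t ^+ 2 * \sum_u h u ^+ 2.
  by rewrite mulr_sumr; apply: eq_bigr => u _; rewrite exprMn.
by rewrite !sq -mulrDr [leRHS]mulrCA ler_pM2l// exprn_gt0.
Qed.

Lemma bilinear_le (M : V -> V -> R) (alpha Delta : R) (k : nat) (f g : V -> R) :
  0 <= alpha ->
  (forall u, \sum_v `|M u v| <= Delta) -> (forall v, \sum_u `|M u v| <= Delta) ->
  (forall S T : {set V}, `|\sum_(u in S) \sum_(v in T) M u v| <=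
     alpha * Num.sqrt (#|S|%:R * #|T|%:R)) ->
  \sum_u \sum_v M u v * (f u * g v) <=
  2 * (2 * alpha * (2 * k + 1)%:R + Delta / 2 ^+ k) *
    (\sum_u f u ^+ 2 + \sum_u g u ^+ 2).
Proof.
move=> al0 rowD colD disc.
pose pos (h : V -> R) u := Num.max (h u) 0.
pose neg (h : V -> R) u := Num.max (- h u) 0.
have pos0 h u : 0 <= pos h u by rewrite /pos le_max lexx orbT.
have neg0 h u : 0 <= neg h u by rewrite /neg le_max lexx orbT.
have split h u : h u = pos h u - neg h u.
  rewrite /pos /neg; case/orP: (le_total 0 (h u)) => h0.
    by rewrite max_l// max_r ?subr0// oppr_le0.
  by rewrite max_r// max_l ?sub0r ?opprK// oppr_ge0.
have splitS h : \sum_u h u ^+ 2 = \sum_u pos h u ^+ 2 + \sum_u neg h u ^+ 2.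
  rewrite -big_split/=; apply: eq_bigr => u _.
  rewrite /pos /neg; case/orP: (le_total 0 (h u)) => h0.
    by rewrite max_l// max_r ?expr0n/= ?addr0// oppr_le0.
  by rewrite max_r// max_l ?sqrrN ?expr0n/= ?add0r// oppr_ge0.
have up (S T : {set V}) : \sum_(u in S) \sum_(v in T) M u v <= alpha * Num.sqrt (#|S|%:R * #|T|%:R).
  exact: le_trans (ler_norm _) (disc S T).
have dn (S T : {set V}) : \sum_(u in S) \sum_(v in T) - M u v <=
    alpha * Num.sqrt (#|S|%:R * #|T|%:R).
  apply: le_trans (disc S T); rewrite -normrN; apply: le_trans (ler_norm _).
  by rewrite -sumrN; apply: ler_sum => u _; rewrite sumrN.
have rowN u : \sum_v `|- M u v| <= Delta.
  by under eq_bigr do rewrite normrN; apply: rowD.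
have colN v : \sum_u `|- M u v| <= Delta.
  by under eq_bigr do rewrite normrN; apply: colD.
have H1 := @bilinear_ge0_le M _ _ k (pos f) (pos g) al0 rowD colD up (pos0 f) (pos0 g).
have H2 := @bilinear_ge0_le M _ _ k (neg f) (neg g) al0 rowD colD up (neg0 f) (neg0 g).
have H3 := @bilinear_ge0_le (fun u v => - M u v) _ _ k (pos f) (neg g)
  al0 rowN colN dn (pos0 f) (neg0 g).
have H4 := @bilinear_ge0_le (fun u v => - M u v) _ _ k (neg f) (pos g)
  al0 rowN colN dn (neg0 f) (pos0 g).
have -> : \sum_u \sum_v M u v * (f u * g v) =
  \sum_u \sum_v M u v * (pos f u * pos g v) + \sum_u \sum_v M u v * (neg f u * neg g v)
  + \sum_u \sum_v - M u v * (pos f u * neg g v)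
  + \sum_u \sum_v - M u v * (neg f u * pos g v).
  rewrite -!big_split/=; apply: eq_bigr => u _.
  rewrite -!big_split/=; apply: eq_bigr => v _.
  by rewrite (split f u) (split g v); ring.
rewrite (splitS f) (splitS g); lra.
Qed.

Variables (A : V -> V -> R) (rho kap : R).
Hypothesis A_ge0 : forall u v, 0 <= A u v.
Hypothesis A_sym : forall u v, A u v = A v u.

(** On vectors orthogonal to d, A differs from M = A - rho (J - I) by the terms
    rho <f,1> <g,1> and rho <f,g>.  The first is small because
    0 = <f,d> = <f, M 1> + rho (n - 1) <f,1> and <f, M 1> is controlled by the
    bound on M.  The form of [centered_adj] at arbitrary f, g is that of A at their
    d-orthogonal projections. *)
Lemma spectral_gap_centered (f g : V -> R) :
  let d := wdeg A in
  let D := rho * #|V|%:R in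
  (1 < #|V|)%N -> 0 <= rho <= 1 -> 0 < D -> 0 < kap ->
  (forall u, D / 2 <= d u) ->
  (forall f g : V -> R,
     \sum_u \sum_v (A u v - rho * (u != v)%:R) * (f u * g v) <=
     kap * (\sum_u f u ^+ 2 + \sum_u g u ^+ 2)) ->
  \sum_u \sum_v centered_adj A d u v * (f u * g v) <=
  2 / D * (kap + 1 / 2 + 8 * kap ^+ 2 / D) *
     (\sum_u d u * f u ^+ 2 + \sum_u d u * g u ^+ 2).
Proof.
move=> d D V2 /andP[rho0 rho1] D0 kap0 dD Mle.
have dE u : d u = \sum_v A u v by [].
have [u0 _] : exists u0 : V, u0 \in V by apply/card_gt0P; exact: ltnW.
have d0 u : 0 < d u by apply: lt_le_trans (dD u); rewrite divr_gt0.
pose vol := \sum_u d u.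
have vol0 : 0 < vol.
  by rewrite /vol (bigD1 u0)//= ltr_pwDl// sumr_ge0// => u _; exact: ltW.
pose n : R := #|V|%:R.
have n2 : 2 <= n by rewrite /n ler_nat.
have rn : D / 2 <= rho * (n - 1).
  by rewrite /D -/n; have := ler_wpM2l rho0 n2; lra.
have rowM u : \sum_v (A u v - rho * (u != v)%:R) = d u - rho * (n - 1).
  rewrite big_split/= sumrN -mulr_sumr -dE; congr (_ - _ * _).
  rewrite (bigD1 u)//= eqxx add0r (eq_bigr (fun=> 1)).
    rewrite sumr_const cardC1 /n; case: #|V| V2 => // k _.
    by rewrite /= -[X in _ = X - _]natr1 addrK.
  by move=> v; rewrite eq_sym => ->.
have ortho_mass (h : V -> R) : \sum_u d u * h u = 0 ->
    rho * (\sum_u h u) ^+ 2 <= 16 * kap ^+ 2 / D * \sum_u h u ^+ 2.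
  move=> hd; set s := \sum_u h u; set a := \sum_u h u ^+ 2.
  have a0 : 0 <= a by rewrite sumr_ge0// => u _; rewrite sqr_ge0.
  pose X := rho * (n - 1) * s.
  have Xt t : - (t * X) <= kap * (t ^+ 2 * a + n).
    have := Mle (fun u => t * h u) (fun=> 1).
    have -> : \sum_u \sum_v (A u v - rho * (u != v)%:R) * (t * h u * 1) = - (t * X).
      transitivity (t * \sum_u h u * (d u - rho * (n - 1))).
        rewrite mulr_sumr; apply: eq_bigr => u _; rewrite -(rowM u) mulrA mulr_sumr.
        by apply: eq_bigr => v _; ring.
      have -> : \sum_u h u * (d u - rho * (n - 1)) =
         \sum_u d u * h u - rho * (n - 1) * s.
        rewrite /s mulr_sumr -sumrN -big_split/=; apply: eq_bigr => u _; ring.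
      by rewrite hd /X; ring.
    have -> : \sum_u (t * h u) ^+ 2 = t ^+ 2 * a.
      by rewrite /a mulr_sumr; apply: eq_bigr => u _; rewrite exprMn.
    by rewrite expr1n sumr_const -/n.
  have X2 : X ^+ 2 <= 4 * kap ^+ 2 * a * n.
    have [a00|an0] := eqVneq a 0.
      have h0 u : h u = 0.
        have /eqP := a00; rewrite /a psumr_eq0; last by move=> v _; exact: sqr_ge0.
        by move=> /allP/(_ u (mem_index_enum _)); rewrite sqrf_eq0 => /eqP.
      by rewrite /X /s big1// a00 !mulr0 mul0r expr0n.
    have ap : 0 < a by rewrite lt_neqAle eq_sym an0.
    (* optimal scaling: the discriminant of the quadratic in t *)
    have := Xt (- X / (2 * kap * a)).
    have ka : 0 < 4 * kap * a by rewrite !mulr_gt0.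
    rewrite -(ler_pM2l ka).
    have -> : 4 * kap * a * - (- X / (2 * kap * a) * X) = 2 * X ^+ 2.
      by field; rewrite !gt_eqF.
    have -> : 4 * kap * a * (kap * ((- X / (2 * kap * a)) ^+ 2 * a + n)) =
       X ^+ 2 + 4 * kap ^+ 2 * a * n by field; rewrite !gt_eqF.
    lra.
  have s2 : (D / 2) ^+ 2 * s ^+ 2 <= X ^+ 2.
    rewrite /X [leRHS]exprMn ler_wpM2r ?sqr_ge0// ler_sqr// nnegrE; first by rewrite divr_ge0// ltW.
    by rewrite (le_trans _ rn)// divr_ge0// ltW.
  have DD : 0 < (D / 2) ^+ 2 by rewrite exprn_gt0// divr_gt0.
  rewrite -(ler_pM2l DD).
  have := ler_wpM2l rho0 (le_trans s2 X2).
  have -> : rho * (4 * kap ^+ 2 * a * n) = 4 * kap ^+ 2 * a * D by rewrite /D -/n; ring.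
  have -> : (D / 2) ^+ 2 * (16 * kap ^+ 2 / D * a) = 4 * kap ^+ 2 * a * D.
    by field; rewrite gt_eqF.
  by rewrite mulrCA.
have ortho (h l : V -> R) : \sum_u d u * h u = 0 -> \sum_u d u * l u = 0 ->
   \sum_u \sum_v A u v * (h u * l v) <=
   2 / D * (kap + 1 / 2 + 8 * kap ^+ 2 / D) *
     (\sum_u d u * h u ^+ 2 + \sum_u d u * l u ^+ 2).
  move=> hd ld; set K := kap + 1 / 2 + _.
  have K0 : 0 <= K.
    have q : 0 <= 8 * kap ^+ 2 / D by rewrite divr_ge0 ?(ltW D0)// mulr_ge0 ?sqr_ge0.
    rewrite /K; lra.
  apply: (@le_trans _ _ (K * (\sum_u h u ^+ 2 + \sum_u l u ^+ 2))); last first.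
    have N2 (z : V -> R) : D / 2 * \sum_u z u ^+ 2 <= \sum_u d u * z u ^+ 2.
      by rewrite mulr_sumr; apply: ler_sum => u _; rewrite ler_wpM2r ?sqr_ge0.
    rewrite mulrAC [leRHS]mulrC ler_wpM2l//.
    have := lerD (N2 h) (N2 l); rewrite -mulrDr => E.
    have D2 : 0 <= 2 / D by rewrite divr_ge0// ltW.
    have := ler_wpM2l D2 E; rewrite mulrA.
    have -> : 2 / D * (D / 2) = 1 by field; rewrite gt_eqF.
    by rewrite mul1r.
  have -> : \sum_u \sum_v A u v * (h u * l v) =
    \sum_u \sum_v (A u v - rho * (u != v)%:R) * (h u * l v)
    + rho * (\sum_u h u) * (\sum_u l u) - rho * \sum_u h u * l u.
    rewrite -mulrA mulr_suml !mulr_sumr -sumrN -!big_split/=; apply: eq_bigr => u _.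
    rewrite mulr_sumr mulr_sumr.
    have -> : rho * (h u * l u) = \sum_v rho * (u == v)%:R * (h u * l v).
      rewrite (bigD1 u)//= eqxx big1 ?addr0 ?mulr1// => v.
      by rewrite eq_sym => /negPf ->; rewrite mulr0 mul0r.
    rewrite -sumrN -!big_split/=; apply: eq_bigr => v _.
    by case: eqP => _ /=; ring.
  have Mhl := Mle h l.
  have mh := ortho_mass h hd; have ml := ortho_mass l ld.
  set s := \sum_u h u in mh *; set s' := \sum_u l u in ml *.
  set a := \sum_u h u ^+ 2 in mh Mhl *; set b := \sum_u l u ^+ 2 in ml Mhl *.
  have E1 : rho * s * s' <= 8 * kap ^+ 2 / D * (a + b).
    have := mulr_ge0 rho0 (sqr_ge0 (s - s')); rewrite sqrrB; lra.
  have E2 : - (rho * \sum_u h u * l u) <= 1 / 2 * (a + b).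
    have E3 : - (2 * \sum_u h u * l u) <= a + b.
      rewrite /a /b -big_split/= mulr_sumr -sumrN; apply: ler_sum => u _.
      by have := sqr_ge0 (h u + l u); rewrite sqrrD; lra.
    have ab : 0 <= a + b.
      by rewrite addr_ge0// sumr_ge0// => u _; rewrite sqr_ge0.
    have := ler_wpM2l rho0 E3; have := ler_wpM2r ab rho1; lra.
  rewrite /K; lra.
pose proj (h : V -> R) u := h u - (\sum_u d u * h u) / vol.
have proj_ortho h : \sum_u d u * proj h u = 0.
  rewrite /proj; under eq_bigr do rewrite mulrBr; rewrite sumrB -mulr_suml -/vol.
  by rewrite mulrCA divff ?mulr1 ?subrr// gt_eqF.
have proj_le h : \sum_u d u * proj h u ^+ 2 <= \sum_u d u * h u ^+ 2.
  set c := (\sum_u d u * h u) / vol.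
  have -> : \sum_u d u * proj h u ^+ 2 =
     \sum_u d u * h u ^+ 2 - 2 * c * (\sum_u d u * h u) + c ^+ 2 * vol.
    rewrite /vol !mulr_sumr -sumrN -!big_split/=; apply: eq_bigr => u _.
    by rewrite /proj -/c; ring.
  have -> : \sum_u d u * h u = c * vol by rewrite divfK ?gt_eqF.
  by have := mulr_ge0 (sqr_ge0 c) (ltW vol0); rewrite expr2; lra.
have -> : \sum_u \sum_v centered_adj A d u v * (f u * g v) =
   \sum_u \sum_v A u v * (proj f u * proj g v).
  rewrite (centered_adj_sum A d) proj_ortho mul0r mul0r addr0.
  have rowB u : \sum_v centered_adj A d u v = 0.
    rewrite /centered_adj big_split/= sumrN -mulr_suml -mulr_sumr -/vol mulfK ?gt_eqF//.
    by rewrite -dE subrr.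
  have symB u v : centered_adj A d u v = centered_adj A d v u.
    by rewrite /centered_adj A_sym [d u * _]mulrC.
  have zero (h : V -> R) : \sum_u \sum_v centered_adj A d u v * h u = 0.
    by rewrite big1// => u _; rewrite -mulr_suml rowB mul0r.
  have zero' (h : V -> R) : \sum_u \sum_v centered_adj A d u v * h v = 0.
    rewrite exchange_big -[RHS](zero h); apply: eq_bigr => u _; apply: eq_bigr => v _.
    by rewrite symB.
  set cf := (\sum_u d u * f u) / vol; set cg := (\sum_u d u * g u) / vol.
  have -> : \sum_u \sum_v centered_adj A d u v * (proj f u * proj g v) =
    \sum_u \sum_v centered_adj A d u v * (f u * g v)
    - (\sum_u \sum_v centered_adj A d u v * (cg * proj f u)
       + \sum_u \sum_v centered_adj A d u v * (cf * g v)).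
    rewrite -big_split/= -sumrN -big_split/=; apply: eq_bigr => u _.
    rewrite -big_split/= -sumrN -big_split/=; apply: eq_bigr => v _.
    by rewrite /proj -/cf -/cg; ring.
  by rewrite (zero (fun u => cg * proj f u)) (zero' (fun v => cf * g v)) addr0 subr0.
apply: le_trans (ortho _ _ (proj_ortho f) (proj_ortho g)) _.
rewrite ler_wpM2l ?lerD ?proj_le// mulr_ge0 ?divr_ge0 ?(ltW D0)//.
have q : 0 <= 8 * kap ^+ 2 / D by rewrite divr_ge0 ?(ltW D0)// mulr_ge0 ?sqr_ge0.
lra.
Qed.

End gap.

(** * Concentration of edge counts in the random graph *)

Section gnp.
Variables (R : realType) (m : nat) (rho : R).
Hypothesis rho01 : 0 <= rho <= 1.
Implicit Types (G : sgraph 'I_m) (E : sgraph 'I_m -> Prop).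

(** Independence of the edges.  Subsets of [{set 'I_m}] containing an element
    that is not a pair get weight 0, so the sum over graphs can be taken over
    all sets of subsets, where the product expands by distributivity. *)
Lemma sgraph_sum_prod (F H : {set 'I_m} -> R) :
  \sum_(G : sgraph 'I_m)
    \prod_(e : {set 'I_m} | (#|e| == 2)%N) (if e \in val G then F e else H e) =
  \prod_(e : {set 'I_m} | (#|e| == 2)%N) (F e + H e).
Proof.
rewrite [RHS]big_mkcond/=.
pose F' (e : {set 'I_m}) := if (#|e| == 2)%N then F e else 0.
pose H' (e : {set 'I_m}) := if (#|e| == 2)%N then H e else 1.
rewrite (eq_bigr (fun e => F' e + H' e)); last first.
  by move=> e _; rewrite /F' /H'; case: ifP; rewrite ?add0r.
rewrite bigA_distr/=.
rewrite -(big_sub [pred J : {set {set 'I_m}} | [forall e in J, (#|e| == 2)%N]]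
  (fun J : {set {set 'I_m}} => \prod_(e : {set 'I_m} | (#|e| == 2)%N)
     (if e \in J then F e else H e))).
rewrite big_mkcond/=; apply: eq_bigr => J _; rewrite inE; case: ifPn.
  move=> /forallP JP; rewrite big_mkcond/=; apply: eq_bigr => e _.
  rewrite /F' /H'; case: ifPn => //; have := JP e.
  by case: (e \in J) => //= ->.
rewrite negb_forall => /existsP[e]; rewrite negb_imply => /andP[eJ en2].
by rewrite (bigD1 e)//= eJ /F' (negPf en2) mul0r.
Qed.

Lemma gnp_weight_ge0 G : 0 <= gnp_weight rho G.
Proof.
have /andP[r0 r1] := rho01.
by rewrite prodr_ge0// => e _; case: ifP; rewrite ?subr_ge0.
Qed.

Lemma gnp_weight_sum : \sum_(G : sgraph 'I_m) gnp_weight rho G = 1.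
Proof.
by rewrite sgraph_sum_prod big1// => e _; rewrite addrC subrK.
Qed.

Lemma gnp_prob_ge0 E : 0 <= gnp_prob rho E.
Proof. by rewrite sumr_ge0// => G _; exact: gnp_weight_ge0. Qed.

Lemma gnp_prob_le E1 E2 : (forall G, E1 G -> E2 G) -> gnp_prob rho E1 <= gnp_prob rho E2.
Proof.
move=> H; rewrite /gnp_prob big_mkcond [leRHS]big_mkcond; apply: ler_sum => G _.
case: asboolP => [/H e2|_]; first by rewrite asboolT.
by case: ifP => // _; exact: gnp_weight_ge0.
Qed.

Lemma gnp_prob_compl E : gnp_prob rho E = 1 - gnp_prob rho (fun G => ~ E G).
Proof.
rewrite -gnp_weight_sum (bigID (fun G => `[< E G >]))/= /gnp_prob.
rewrite [X in _ = _ + X - _](eq_bigl (fun G => `[< ~ E G >])) ?addrK// => G.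
by rewrite asbool_neg.
Qed.

Lemma gnp_prob_exists (I : finType) (P : pred I) (E : I -> sgraph 'I_m -> Prop) :
  gnp_prob rho (fun G => exists2 i, P i & E i G) <= \sum_(i | P i) gnp_prob rho (E i).
Proof.
rewrite /gnp_prob.
under [leRHS]eq_bigr do rewrite big_mkcond/=.
rewrite exchange_big big_mkcond/=; apply: ler_sum => G _.
have w0 := gnp_weight_ge0 G.
case: asboolP => [[i Pi EG]|_]; last by rewrite sumr_ge0// => i _; case: ifP.
by rewrite (bigD1 i)//= asboolT// lerDl sumr_ge0// => j _; case: ifP.
Qed.

Lemma gnp_prob_or E1 E2 :
  gnp_prob rho (fun G => E1 G \/ E2 G) <= gnp_prob rho E1 + gnp_prob rho E2.
Proof.
rewrite /gnp_prob big_mkcond [X in _ <= X + _]big_mkcond [X in _ <= _ + X]big_mkcond.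
rewrite -big_split/=; apply: ler_sum => G _.
have w0 := gnp_weight_ge0 G.
case: asboolP => [[e|e]|_].
- by rewrite asboolT// lerDl; case: ifP.
- by rewrite (asboolT e) lerDr; case: ifP.
- by rewrite addr_ge0//; case: ifP.
Qed.

Lemma expR_sub1_le (c : R) : expR c - 1 - c <= c ^+ 2 * expR `|c|.
Proof.
have h1 : expR c - 1 <= c * expR c.
  have := expR_ge1Dx (- c); rewrite -(ler_pM2r (expR_gt0 c)) -expRD addNr expR0; lra.
have h2 := expR_ge1Dx c.
rewrite expr2; have [c0|c0] := leP 0 c.
  rewrite ger0_norm//; have := ler_wpM2l c0 h1; have : c <= c * expR c.
    by rewrite ler_peMr// -expR0 ler_expR.
  suff : expR c - 1 - c <= c * (expR c - 1) by lra.
  lra.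
have e1 : 1 <= expR `|c| by rewrite -expR0 ler_expR.
have cc : 0 <= c * c by nra.
apply: (@le_trans _ _ (c * c)); last by rewrite ler_peMr.
have := ler_wnM2l (ltW c0) h2; lra.
Qed.

Lemma bernoulli_mgf_le (c : R) :
  rho * expR (c * (1 - rho)) + (1 - rho) * expR (- (c * rho)) <=
  expR (rho * (c ^+ 2 * expR `|c|)).
Proof.
have /andP[r0 r1] := rho01.
have -> : rho * expR (c * (1 - rho)) + (1 - rho) * expR (- (c * rho)) =
  expR (- (c * rho)) * (1 + rho * (expR c - 1)).
  have -> : c * (1 - rho) = - (c * rho) + c by ring.
  by rewrite expRD; ring.
apply: (@le_trans _ _ (expR (- (c * rho)) * expR (rho * (expR c - 1)))).
  by rewrite ler_wpM2l ?expR_ge0// expR_ge1Dx.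
rewrite -expRD ler_expR.
have := ler_wpM2l r0 (expR_sub1_le c); lra.
Qed.

Definition edge_sum (c : {set 'I_m} -> R) G : R :=
  \sum_(e : {set 'I_m} | (#|e| == 2)%N) c e * ((e \in val G)%:R - rho).

(** Exponential Markov inequality at parameter 1; any other parameter is
    absorbed into the coefficients c. *)
Lemma edge_sum_chernoff (c : {set 'I_m} -> R) (b w tau : R) :
  (forall e : {set 'I_m}, (#|e| == 2)%N -> `|c e| <= b) ->
  \sum_(e : {set 'I_m} | (#|e| == 2)%N) c e ^+ 2 <= w ->
  gnp_prob rho (fun G => tau <= edge_sum c G) <= expR (rho * (w * expR b) - tau).
Proof.
move=> cb cw; have /andP[r0 r1] := rho01.
apply: (@le_trans _ _ (\sum_(G : sgraph 'I_m) gnp_weight rho G * expR (edge_sum c G - tau))).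
  rewrite /gnp_prob big_mkcond/=; apply: ler_sum => G _.
  have w0 := gnp_weight_ge0 G; case: asboolP => [h|_].
    by rewrite ler_peMr// -expR0 ler_expR subr_ge0.
  by rewrite mulr_ge0// expR_ge0.
under eq_bigr do rewrite expRD mulrA.
rewrite -mulr_suml [leRHS]expRD ler_wpM2r ?expR_ge0//.
have -> : \sum_(G : sgraph 'I_m) gnp_weight rho G * expR (edge_sum c G) =
  \prod_(e : {set 'I_m} | (#|e| == 2)%N)
    (rho * expR (c e * (1 - rho)) + (1 - rho) * expR (- (c e * rho))).
  rewrite -sgraph_sum_prod; apply: eq_bigr => G _.
  rewrite /gnp_weight /edge_sum expR_sum -big_split/=; apply: eq_bigr => e _.
  by case: ifP => _ //=; congr (_ * expR _); ring.
apply: (@le_trans _ _ (\prod_(e : {set 'I_m} | (#|e| == 2)%N)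
    expR (rho * (c e ^+ 2 * expR b)))).
  apply: ler_prod => e e2; apply/andP; split.
    by rewrite addr_ge0// mulr_ge0 ?expR_ge0// subr_ge0.
  apply: le_trans (bernoulli_mgf_le _) _; rewrite ler_expR ler_wpM2l//.
  by rewrite ler_wpM2l ?sqr_ge0// ler_expR cb.
rewrite -expR_sum ler_expR -mulr_sumr ler_wpM2l// -mulr_suml ler_wpM2r// expR_ge0.
Qed.

(** Pairs inside both S and T are counted in both orders, so this is the
    bilinear form of A - rho (J - I) at the indicators of S and T. *)
Definition centered_cut (S T : {set 'I_m}) G : R :=
  \sum_(u in S) \sum_(v in T) (adjr R G u v - rho * (u != v)%:R).

Definition cut_count (S T : {set 'I_m}) (e : {set 'I_m}) : nat :=
  #|[set q in finset.setX S T | [set q.1; q.2] == e]|.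

Lemma adj_card2 G u v : adj G u v -> #|[set u; v]| == 2.
Proof. by move=> auv; have /forallP/(_ [set u; v]) := valP G; rewrite -/(adj G u v) auv. Qed.

Lemma centered_cutE (S T : {set 'I_m}) G :
  centered_cut S T G = edge_sum (fun e => (cut_count S T e)%:R) G.
Proof.
rewrite /centered_cut pair_big/=.
rewrite (bigID (fun q : 'I_m * 'I_m => #|[set q.1; q.2]| == 2))/=.
rewrite [X in _ + X]big1 ?addr0; last first.
  move=> [u v] /= /andP[_]; rewrite cards2; case: (eqVneq u v) => [->|//] _.
  rewrite /adjr; have -> : adj G v v = false.
    by apply/negbTE/negP => /adj_card2; rewrite cards2 eqxx.
  by rewrite /= mulr0n mulr0 subr0.
rewrite (partition_big (fun q : 'I_m * 'I_m => [set q.1; q.2]) (fun e => #|e| == 2))/=;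
  last by move=> q /andP[].
apply: eq_bigr => e e2.
rewrite /cut_count -sum1_card natr_sum mulr_suml.
apply: eq_big => [[u v]|[u v]] /=.
  rewrite !inE/=; case: (eqVneq [set u; v] e) => [->|]; last by rewrite !andbF.
  by rewrite e2 !andbT.
move=> /andP[/andP[_ uv2] /eqP <-]; rewrite mul1r /adjr /adj.
by move: uv2; rewrite cards2; case: (eqVneq u v) => //= _ _; rewrite mulr1.
Qed.

Lemma cut_count_le2 (S T e : {set 'I_m}) : #|e| == 2 -> (cut_count S T e <= 2)%N.
Proof.
move=> /cards2P[a [b [ab ->]]].
apply: (@leq_trans #|[set (a, b); (b, a)]|); last by rewrite cards2; case: eqP.
apply/subset_leq_card/fintype.subsetP => -[u v]; rewrite !inE/= => /andP[_ /eqP uv].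
have : u \in [set a; b] by rewrite -uv !inE eqxx.
have : v \in [set a; b] by rewrite -uv !inE eqxx orbT.
have : a \in [set u; v] by rewrite uv !inE eqxx.
have : b \in [set u; v] by rewrite uv !inE eqxx orbT.
rewrite !inE !xpair_eqE => bu au _ ua; move: ua bu au => /orP[] /eqP ->.
  by rewrite eqxx [b == a]eq_sym (negPf ab)/= [v == b]eq_sym => ->.
by rewrite eqxx (negPf ab)/= [v == a]eq_sym => _ ->; rewrite orbT.
Qed.

Lemma sum_cut_count (S T : {set 'I_m}) :
  (\sum_(e : {set 'I_m} | #|e| == 2) cut_count S T e <= #|S| * #|T|)%N.
Proof.
rewrite -cardsX -[leqRHS]sum1_card.
rewrite (eq_bigr (fun e => \sum_(q in finset.setX S T | [set q.1; q.2] == e) 1)%N); last first.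
  move=> e _; rewrite /cut_count -sum1_card; apply: eq_bigl => q.
  by rewrite !inE.
rewrite (exchange_big_dep (mem (finset.setX S T)))/= => [|e q _ /andP[]//].
apply: leq_sum => q qST; rewrite sum1_card.
apply: (@leq_trans #|[set [set q.1; q.2]]|); last by rewrite cards1.
by apply/subset_leq_card/fintype.subsetP => e; rewrite !inE => /andP[_ /andP[_ /eqP ->]].
Qed.

Lemma centered_cut_concentration (S T : {set 'I_m}) (theta tau : R) : 0 <= theta ->
  gnp_prob rho (fun G => tau <= `|centered_cut S T G|) <=
  2 * expR (2 * rho * (#|S|%:R * #|T|%:R) * theta ^+ 2 * expR (2 * theta) - theta * tau).
Proof.
move=> th0.
have one (s : R) : `|s| = 1 ->
    gnp_prob rho (fun G => tau <= s * centered_cut S T G) <=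
    expR (2 * rho * (#|S|%:R * #|T|%:R) * theta ^+ 2 * expR (2 * theta) - theta * tau).
  move=> s1; pose c e := theta * s * (cut_count S T e)%:R.
  have cE e : `|c e| = theta * (cut_count S T e)%:R.
    by rewrite /c !normrM s1 mulr1 !ger0_norm.
  apply: le_trans (gnp_prob_le (E2 := fun G => theta * tau <= edge_sum c G) _) _.
    move=> G /(ler_wpM2l th0) /le_trans; apply.
    rewrite centered_cutE /edge_sum !mulr_sumr le_eqVlt; apply/orP; left; apply/eqP.
    by apply: eq_bigr => e _; rewrite /c; ring.
  apply: le_trans (@edge_sum_chernoff c (2 * theta)
     (2 * theta ^+ 2 * (#|S|%:R * #|T|%:R)) (theta * tau) _ _) _.
  - by move=> e e2; rewrite cE mulrC ler_wpM2r// ler_nat cut_count_le2.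
  - apply: (@le_trans _ _ (\sum_(e : {set 'I_m} | (#|e| == 2)%N)
      2 * theta ^+ 2 * (cut_count S T e)%:R)).
      apply: ler_sum => e e2; rewrite -real_normK ?num_real// cE exprMn.
      rewrite [2 * _]mulrC -[leRHS]mulrA ler_wpM2l ?sqr_ge0// expr2
        ler_wpM2r// ler_nat cut_count_le2//.
    rewrite -mulr_sumr ler_wpM2l ?mulr_ge0 ?sqr_ge0//.
    by rewrite -natr_sum -natrM ler_nat sum_cut_count.
  by rewrite ler_expR le_eqVlt; apply/orP; left; apply/eqP; ring.
have e1 := one 1 (normr1 _); have e2 := one (- 1) (normrN1 _).
apply: le_trans (gnp_prob_le (E2 := fun G => tau <= 1 * centered_cut S T G \/
   tau <= - 1 * centered_cut S T G) _) _.
  by move=> G; rewrite mul1r mulN1r ler_normr => /orP.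
apply: le_trans (gnp_prob_or _ _) _; lra.
Qed.

End gnp.

(** * Counting small sets of vertices *)

Section count.
Variable R : realType.

(** Logarithm of (e m / t)^t, the standard bound for the number of subsets
    with at most t elements. *)
Definition subset_entropy (m t : nat) : R := t%:R * (1 + ln (m%:R / t%:R)).

Lemma sum_expr_card (m : nat) (z : R) :
  \sum_(S : {set 'I_m}) z ^+ #|S| = (1 + z) ^+ m.
Proof.
have := @bigA_distr R 0 1 *%R +%R 'I_m (fun=> z) (fun=> 1).
rewrite prodr_const card_ord addrC => ->; apply: eq_bigr => S _.
by rewrite -big_mkcond/= prodr_const.
Qed.

(** Compare with the generating function sum_S z^|S| = (1 + z)^m <= e^(z m) at
    z = t / m <= 1, where every set counted contributes at least z^t. *)
Lemma card_small_subsets_le (m t : nat) : (0 < t <= m)%N ->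
  \sum_(S : {set 'I_m} | (#|S| <= t)%N) 1 <= expR (subset_entropy m t).
Proof.
move=> /andP[t0 tm].
have tp : 0 < t%:R :> R by rewrite ltr0n.
have mp : 0 < m%:R :> R by rewrite ltr0n (leq_trans t0).
pose z : R := t%:R / m%:R.
have z0 : 0 < z by rewrite divr_gt0.
have z1 : z <= 1 by rewrite ler_pdivrMr// mul1r ler_nat.
have zt : 0 < z ^+ t by rewrite exprn_gt0.
have -> : expR (subset_entropy m t) = expR t%:R / z ^+ t.
  rewrite /subset_entropy mulrDr mulr1 expRD; congr (_ * _).
  have -> : m%:R / t%:R = z^-1 by rewrite /z invf_div.
  by rewrite expRM_natl lnK ?exprVn// posrE invr_gt0.
rewrite ler_pdivlMr// mulr_suml.
apply: (@le_trans _ _ (\sum_(S : {set 'I_m}) z ^+ #|S|)).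
  rewrite [leRHS](bigID (fun S : {set 'I_m} => #|S| <= t)%N)/=.
  rewrite -[leLHS]addr0 lerD// ?sumr_ge0//; last by move=> S _; rewrite exprn_ge0// ltW.
  by apply: ler_sum => S St; rewrite mul1r ler_wiXn2l// ltW.
rewrite sum_expr_card.
have -> : expR t%:R = expR z ^+ m :> R.
  by rewrite -expRM_natr; congr expR; rewrite /z divfK// gt_eqF.
by rewrite lerXn2r ?nnegrE ?expR_ge0 ?expR_ge1Dx// addr_ge0// ltW.
Qed.

Lemma ln_le_subset_entropy (m t : nat) : (0 < t <= m)%N ->
  ln m%:R <= subset_entropy m t.
Proof.
move=> /andP[t0 tm].
have tp : 0 < t%:R :> R by rewrite ltr0n.
have t1 : 1 <= t%:R :> R by rewrite ler1n.
have x1 : 1 <= m%:R / t%:R :> R by rewrite ler_pdivlMr// mul1r ler_nat.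
have xp : 0 < m%:R / t%:R :> R by lra.
have -> : ln m%:R = ln t%:R + ln (m%:R / t%:R) :> R.
  by rewrite -lnM ?posrE// mulrC divfK// gt_eqF.
rewrite /subset_entropy mulrDr mulr1; apply: lerD.
  exact/ltW/ln_sublinear.
by rewrite ler_peMl// ln_ge0.
Qed.

End count.

(** * Pseudorandomness with high probability *)

Section tails.
Variable R : realType.

Lemma expR1_le4 : expR 1 <= 4 :> R.
Proof.
have h := expR_ge1Dx (- (1 / 2) : R).
have e : expR 1 = (expR (- (1 / 2)))^-1 ^+ 2 :> R.
  by rewrite -expRN opprK -expRM_natl; congr expR; lra.
have p := expR_gt0 (- (1 / 2) : R).
have : (expR (- (1 / 2)))^-1 <= 2 :> R.
  by rewrite -[leRHS]invrK lef_pV2 ?posrE//; lra.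
rewrite e => h2; have -> : 4 = 2 ^+ 2 :> R by rewrite -natrX.
by rewrite lerXn2r ?nnegrE// invr_ge0 ltW.
Qed.

Variables (m : nat) (rho xi a : R).

(** Chernoff's bound with theta = L / (12 a^4), L = 1 + ln (m / t), so that
    t L is the entropy of T.  The linear term theta tau is at least
    2 (xi + 4) t L because sqrt(st) >= t / a^2 for pairs that are not too
    unbalanced.  The quadratic term is at most half of it: its factor rho t is
    a^8 e^(1-L), and this exponential decay beats both L and e^(2 theta). *)
Lemma cut_tail (S T : {set 'I_m}) :
  let K := 24 * (xi + 4) in
  0 < xi -> 0 <= rho <= 1 -> 1 <= a -> a ^+ 8 = rho * m%:R ->
  (0 < #|S| <= #|T|)%N -> #|T|%:R <= #|S|%:R * a ^+ 4 ->
  gnp_prob rho (fun G => K * a ^+ 6 * Num.sqrt (#|S|%:R * #|T|%:R) <=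
     `|centered_cut rho S T G|) <=
  2 * expR (- (xi + 4) * subset_entropy R m #|T|).
Proof.
move=> K xi0 rho01 a1 am /andP[s0 st] tsa; have /andP[rho0 rho1] := rho01.
set s : R := #|S|%:R in tsa *; set t : R := #|T|%:R in tsa *.
have sp : 0 < s by rewrite ltr0n.
have slet : s <= t by rewrite ler_nat.
have tp : 0 < t by lra.
have tm : (#|T| <= m)%N by rewrite -[leqRHS]card_ord max_card.
have mp : 0 < m%:R :> R by rewrite ltr0n (leq_trans _ tm)// (leq_trans s0).
pose sg := Num.sqrt (s * t); rewrite -/sg.
have sg2 : sg ^+ 2 = s * t by rewrite sqr_sqrtr// mulr_ge0// ltW.
have sg0 : 0 <= sg by apply: sqrtr_ge0.
have a0 : 0 < a by lra.
have sgt : sg <= t.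
  by rewrite -ler_sqr ?nnegrE ?(ltW tp)// sg2 expr2 ler_wpM2r// ltW.
have tsg : t <= sg * a ^+ 2.
  rewrite -ler_sqr ?nnegrE ?(ltW tp)//; last by rewrite mulr_ge0// exprn_ge0// ltW.
  rewrite exprMn sg2 -exprM.
  by have := ler_wpM2r (ltW tp) tsa; rewrite expr2 mulrAC.
pose L : R := 1 + ln (m%:R / t).
have x1 : 1 <= m%:R / t by rewrite ler_pdivlMr// mul1r ler_nat.
have L1 : 1 <= L by rewrite lerDl ln_ge0.
have eL : rho * t * expR L = a ^+ 8 * expR 1.
  by rewrite am /L expRD lnK ?posrE//; [field; rewrite gt_eqF|lra].
pose theta := L / (12 * a ^+ 4).
have a4 : 1 <= a ^+ 4 by rewrite exprn_ege1.
have th0 : 0 < theta by rewrite divr_gt0 ?mulr_gt0//; lra.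
apply: le_trans (centered_cut_concentration rho01 S T _ (ltW th0)) _.
rewrite ler_pM2l// ler_expR -/s -/t.
have thL : 2 * theta <= L / 6.
  rewrite /theta; have -> : 2 * (L / (12 * a ^+ 4)) = L / 6 / a ^+ 4.
    by field; rewrite gt_eqF.
  by rewrite ler_pdivrMr ?ler_peMr//; lra.
have Lhalf : L <= 2 * expR (L / 2) by have := expR_ge1Dx (L / 2); lra.
have F1 : 4 * rho * sg * theta * expR (2 * theta) <= K * a ^+ 6.
  have step : theta * expR (2 * theta) <= 1 / (6 * a ^+ 4) * expR L.
    have -> : theta = L * (1 / (12 * a ^+ 4)) by rewrite /theta; field; rewrite gt_eqF.
    apply: (@le_trans _ _ (2 * expR (L / 2) * (1 / (12 * a ^+ 4)) * expR (L / 6))).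
      have c0 : 0 < 1 / (12 * a ^+ 4) by rewrite divr_gt0// mulr_gt0//; lra.
      have L0 : 0 <= L by lra.
      have thE : L * (1 / (12 * a ^+ 4)) = theta by rewrite mulrA mulr1.
      apply: ler_pM.
      - by rewrite mulr_ge0// ltW.
      - exact: expR_ge0.
      - by rewrite ler_wpM2r// ltW.
      - by rewrite ler_expR thE.
    have -> : 2 * expR (L / 2) * (1 / (12 * a ^+ 4)) * expR (L / 6) =
       1 / (6 * a ^+ 4) * (expR (L / 2) * expR (L / 6)) by field; rewrite gt_eqF.
    apply: ler_wpM2l; first by apply: divr_ge0 => //; lra.
    by rewrite -expRD ler_expR; lra.
  have rs : 0 <= rho * sg by rewrite mulr_ge0.
  have rst : rho * sg <= rho * t by rewrite ler_wpM2l.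
  apply: (@le_trans _ _ (4 * (rho * t * (1 / (6 * a ^+ 4) * expR L)))).
    have -> : 4 * rho * sg * theta * expR (2 * theta) =
      4 * (rho * sg * (theta * expR (2 * theta))) by ring.
    rewrite ler_pM2l//; apply: ler_pM => //.
    by rewrite mulr_ge0 ?expR_ge0// ltW.
  have -> : 4 * (rho * t * (1 / (6 * a ^+ 4) * expR L)) =
    2 / 3 / a ^+ 4 * (rho * t * expR L) by field; rewrite gt_eqF.
  rewrite eL; have -> : 2 / 3 / a ^+ 4 * (a ^+ 8 * expR 1) = 2 / 3 * expR 1 * a ^+ 4.
    by field; rewrite gt_eqF.
  have a46 : a ^+ 4 <= a ^+ 6 by rewrite ler_weXn2l.
  apply: ler_pM; rewrite ?mulr_ge0 ?expR_ge0 ?divr_ge0//; try lra.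
  have := expR1_le4; rewrite /K; lra.
have F2 : (xi + 4) * (t * L) <= 1 / 2 * (theta * (K * a ^+ 6 * sg)).
  have -> : 1 / 2 * (theta * (K * a ^+ 6 * sg)) = (xi + 4) * (sg * a ^+ 2 * L).
    by rewrite /theta /K; field; rewrite gt_eqF.
  rewrite ler_pM2l; last lra.
  by rewrite ler_wpM2r//; lra.
have F3 : 2 * rho * (s * t) * theta ^+ 2 * expR (2 * theta) <=
    1 / 2 * (theta * (K * a ^+ 6 * sg)).
  have -> : 2 * rho * (s * t) * theta ^+ 2 * expR (2 * theta) =
    1 / 2 * (theta * ((4 * rho * sg * theta * expR (2 * theta)) * sg)).
    by rewrite -sg2; field.
  by rewrite ler_pM2l// ler_pM2l// ler_wpM2r.
rewrite /subset_entropy -/t -/L; lra.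
Qed.

Lemma degree_tail (u : 'I_m) : 0 <= rho <= 1 ->
  gnp_prob rho (fun G => rho * m%:R / 4 <= `|centered_cut rho [set u] [set: 'I_m] G|) <=
  2 * expR (- (rho * m%:R / 256)).
Proof.
move=> rho01; have /andP[rho0 rho1] := rho01.
(* theta = 1/32 makes the exponent at most - d / 256 *)
have th : 0 <= 32^-1 :> R by lra.
apply: le_trans (centered_cut_concentration rho01 _ _ _ th) _.
rewrite ler_pM2l// ler_expR cards1 cardsT card_ord mul1r.
have D0 : 0 <= rho * m%:R by rewrite mulr_ge0.
have e2 : expR (2 / 32) <= 2 :> R.
  have h := expR_ge1Dx (- (2 / 32) : R); rewrite expRN in h.
  rewrite -[leLHS]invrK -[leRHS]invrK lef_pV2 ?posrE ?invr_gt0 ?expR_gt0//; lra.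
have := ler_wpM2l D0 e2; rewrite expr2; lra.
Qed.

(** Discrepancy is only asked for pairs with |S| <= |T| <= |S| sqrt(d), where
    the union bound over T is affordable; more unbalanced pairs are covered by
    the degree condition ([pseudorandom_discrepancy]). *)
Definition pseudorandom (K : R) (G : sgraph 'I_m) :=
  (forall u, `|centered_cut rho [set u] [set: 'I_m] G| < rho * m%:R / 4) /\
  (forall S T : {set 'I_m}, (0 < #|S| <= #|T|)%N -> #|T|%:R <= #|S|%:R * a ^+ 4 ->
     `|centered_cut rho S T G| < K * a ^+ 6 * Num.sqrt (#|S|%:R * #|T|%:R)).

(** The exponent (xi + 4) tL is spent as follows: one tL pays for the choice of
    S, one for the choice of T within its cardinality, and tL >= ln m turns the
    remaining ones into a power of m, a factor m being lost in the sum over t. *)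
Lemma sum_pairs_entropy_le : 0 < xi -> (0 < m)%N ->
  \sum_(q : {set 'I_m} * {set 'I_m} | (0 < #|q.2| <= #|q.1|)%N)
    expR (- (xi + 4) * subset_entropy R m #|q.1|) <= m%:R `^ (- (xi + 1)).
Proof.
move=> xi0 m0; have mp : 0 < m%:R :> R by rewrite ltr0n.
have cardm (T : {set 'I_m}) : (#|T| <= m)%N by rewrite -[leqRHS]card_ord max_card.
pose H t := subset_entropy R m t.
pose c : R := expR (- (xi + 2) * ln m%:R).
have c0 : 0 < c by exact: expR_gt0.
apply: (@le_trans _ _ (\sum_(q : {set 'I_m} * {set 'I_m} |
    (0 < #|q.1|)%N && (#|q.2| <= #|q.1|)%N) expR (- (xi + 4) * H #|q.1|))).
  rewrite big_mkcond [leRHS]big_mkcond; apply: ler_sum => -[T S] _ /=.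
  case: ifP => [/andP[S0 ST]|_]; first by rewrite ST (leq_trans S0 ST).
  by case: ifP => // _; exact: expR_ge0.
rewrite -(pair_big_dep (fun T : {set 'I_m} => 0 < #|T|)%N
  (fun T S : {set 'I_m} => #|S| <= #|T|)%N (fun T _ => expR (- (xi + 4) * H #|T|)))/=.
apply: (@le_trans _ _ (\sum_(T : {set 'I_m} | (0 < #|T|)%N) c * expR (- H #|T|))).
  apply: ler_sum => T T0.
  have T0m : (0 < #|T| <= m)%N by rewrite T0 cardm.
  have -> : \sum_(S : {set 'I_m} | (#|S| <= #|T|)%N) expR (- (xi + 4) * H #|T|) =
     expR (- (xi + 4) * H #|T|) * \sum_(S : {set 'I_m} | (#|S| <= #|T|)%N) 1.
    by rewrite mulr_sumr; apply: eq_bigr => S _; rewrite mulr1.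
  have := ler_wpM2l (expR_ge0 (- (xi + 4) * H #|T|)) (card_small_subsets_le R T0m).
  move=> /le_trans; apply; rewrite -/(H _) -!expRD ler_expR.
  have h := @ln_le_subset_entropy R _ _ T0m; rewrite -/(H _) in h.
  have x2 : 0 <= xi + 2 by lra.
  have := ler_wpM2l x2 h; lra.
rewrite -mulr_sumr.
apply: (@le_trans _ _ (c * m%:R)); last first.
  rewrite -[X in _ * X]lnK ?posrE// /c -expRD /powR gt_eqF// ler_expR.
  lra.
rewrite ler_wpM2l ?(ltW c0)//.
rewrite (partition_big (fun T : {set 'I_m} => inord #|T| : 'I_m.+1)
  (fun t : 'I_m.+1 => 0 < t)%N)/=; last by move=> T T0; rewrite inordK ?ltnS.
apply: (@le_trans _ _ (\sum_(t < m.+1 | (0 < t)%N) (1 : R))); last first.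
  by rewrite big_mkcond big_ord_recl/= add0r sumr_const card_ord.
apply: ler_sum => t t0.
have tm : (0 < t <= m)%N by rewrite t0 -ltnS ltn_ord.
apply: (@le_trans _ _ (\sum_(T : {set 'I_m} | (#|T| <= t)%N) expR (- H t))).
  rewrite big_mkcond [leRHS]big_mkcond; apply: ler_sum => T _.
  case: ifP => [/andP[T0 /eqP tT]|_].
    have -> : #|T| = t by rewrite -tT inordK// ltnS.
    by rewrite leqnn.
  by case: ifP => // _; exact: expR_ge0.
have -> : \sum_(T : {set 'I_m} | (#|T| <= t)%N) expR (- H t) =
   expR (- H t) * \sum_(T : {set 'I_m} | (#|T| <= t)%N) 1.
  by rewrite mulr_sumr; apply: eq_bigr => S _; rewrite mulr1.
apply: le_trans (ler_wpM2l (expR_ge0 _) (card_small_subsets_le R tm)) _.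
by rewrite -/(H t) -expRD addNr expR0.
Qed.

Lemma pseudorandom_prob :
  let K := 24 * (xi + 4) in
  0 < xi -> 0 <= rho <= 1 -> 1 <= a -> a ^+ 8 = rho * m%:R -> (0 < m)%N ->
  256 * (xi + 1) * ln m%:R <= rho * m%:R ->
  1 - 4 / m%:R `^ xi <= gnp_prob rho (pseudorandom K).
Proof.
move=> K xi0 rho01 a1 am m0 hk; have mp : 0 < m%:R :> R by rewrite ltr0n.
have m1 : 1 <= m%:R :> R by rewrite ler1n.
rewrite gnp_prob_compl// lerD2l lerN2.
pose E1 (u : 'I_m) G := rho * m%:R / 4 <= `|centered_cut rho [set u] [set: 'I_m] G|.
pose P (q : {set 'I_m} * {set 'I_m}) :=
  (0 < #|q.2| <= #|q.1|)%N && (#|q.1|%:R <= #|q.2|%:R * a ^+ 4)%R.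
pose E2 (q : {set 'I_m} * {set 'I_m}) G :=
  K * a ^+ 6 * Num.sqrt (#|q.2|%:R * #|q.1|%:R) <= `|centered_cut rho q.2 q.1 G|.
apply: (@le_trans _ _ (gnp_prob rho (fun G => (exists2 u, xpredT u & E1 u G) \/
    (exists2 q, P q & E2 q G)))).
  apply: gnp_prob_le => // G nG; apply: contrapT => nE; apply: nG; split.
    move=> u; rewrite ltNge; apply/negP => h; apply: nE; left; exists u => //.
  move=> S T h1 h2; rewrite ltNge; apply/negP => h; apply: nE; right.
  by exists (T, S) => //; rewrite /P/= h1 h2.
apply: le_trans (gnp_prob_or rho01 _ _) _.
have -> : 4 / m%:R `^ xi = 2 * m%:R `^ (- xi) + 2 * m%:R `^ (- xi) :> R.
  by rewrite powRN; lra.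
apply: lerD.
  apply: le_trans (gnp_prob_exists rho01 _ _) _.
  apply: (@le_trans _ _ (\sum_(u : 'I_m) 2 * expR (- (rho * m%:R / 256)))).
    by apply: ler_sum => u _; exact: degree_tail.
  rewrite sumr_const card_ord -[leLHS]mulr_natr -[leLHS]mulrA ler_pM2l//.
  rewrite -[X in _ * X]lnK ?posrE// -expRD /powR gt_eqF// ler_expR; lra.
apply: le_trans (gnp_prob_exists rho01 _ _) _.
apply: (@le_trans _ _ (\sum_(q | P q)
   2 * expR (- (xi + 4) * subset_entropy R m #|q.1|))).
  by apply: ler_sum => -[T S] /andP[h1 h2]; exact: cut_tail.
rewrite -mulr_sumr ler_pM2l//.
apply: (@le_trans _ _ (m%:R `^ (- (xi + 1)))); last first.
  by apply: ler_powR => //; lra.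
apply: le_trans (sum_pairs_entropy_le xi0 m0).
rewrite big_mkcond [leRHS]big_mkcond; apply: ler_sum => q _.
rewrite /P; case: ifP => [/andP[->//]|_].
by case: ifP => // _; exact: expR_ge0.
Qed.

End tails.

(** * The first eigenvalue of a random graph *)

Section assembly.
Variables (R : realType) (m : nat) (rho a K : R) (G : sgraph 'I_m).

Let A := @adjr R m G.

(** The spectral gap obtained is gap_const K * d^(-1/8). *)
Definition gap_const (K : R) : R :=
  4 * ((8 * K + 12) + 1 + 8 * (8 * K + 12) ^+ 2).

Lemma centered_cut_row (u : 'I_m) :
  centered_cut rho [set u] [set: 'I_m] G = wdeg A u - rho * (m%:R - 1).
Proof.
rewrite /centered_cut big_set1 big_split/=; congr (_ + _).
  by apply: eq_bigl => v; rewrite inE.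
rewrite sumrN -mulr_sumr; congr (- (_ * _)).
rewrite (eq_bigl xpredT) => [|v]; last by rewrite inE.
rewrite (bigD1 u)//= eqxx add0r (eq_bigr (fun=> 1)); last first.
  by move=> v; rewrite eq_sym => ->.
rewrite sumr_const cardC1 card_ord; case: m u => [[]//|k _].
by rewrite /= -[X in _ = X - _]natr1 addrK.
Qed.

Lemma centered_cut_sym (S T : {set 'I_m}) :
  centered_cut rho S T G = centered_cut rho T S G.
Proof.
rewrite /centered_cut exchange_big; apply: eq_bigr => u _; apply: eq_bigr => v _.
by rewrite (adjr_sym _ _ v) (eq_sym v).
Qed.

Lemma pseudorandom_wdeg_ge : (4 <= m)%N -> 0 <= rho <= 1 ->
  pseudorandom rho a K G -> forall u, rho * m%:R / 2 <= wdeg A u.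
Proof.
move=> m4 /andP[rho0 rho1] [degG _] u.
have m4' : 4 <= m%:R :> R by rewrite ler_nat.
have := degG u; rewrite centered_cut_row ltr_norml => /andP[+ _].
have := ler_wpM2l rho0 m4'; lra.
Qed.

(** If |T| > |S| a^4, the cut is at most |S| times the row sum bound 3 a^8,
    and a^2 |S| <= sqrt(|S||T|). *)
Lemma pseudorandom_discrepancy : (4 <= m)%N -> 0 <= rho <= 1 -> 1 <= a ->
  a ^+ 8 = rho * m%:R -> 3 <= K -> pseudorandom rho a K G ->
  (forall u, \sum_v `|A u v - rho * (u != v)%:R| <= 3 * a ^+ 8) /\
  (forall S T : {set 'I_m}, `|centered_cut rho S T G| <=
     K * a ^+ 6 * Num.sqrt (#|S|%:R * #|T|%:R)).
Proof.
move=> m4 /andP[rho0 rho1] a1 am K3 [degG cutG].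
have a0 : 0 < a by lra.
have row u : \sum_v `|A u v - rho * (u != v)%:R| <= 3 * a ^+ 8.
  apply: (@le_trans _ _ (\sum_v (A u v + rho))).
    apply: ler_sum => v _; apply: le_trans (ler_normB _ _) _.
    rewrite !ger0_norm ?mulr_ge0 ?adjr_ge0// lerD2l.
    by case: (u != v); rewrite /= ?mulr1// mulr0.
  rewrite big_split/= sumr_const card_ord -[rho *+ m]mulr_natr -am.
  have := degG u; rewrite centered_cut_row ltr_norml -am => /andP[_].
  have rm : rho * (m%:R - 1) <= a ^+ 8 by rewrite am; lra.
  have a8 : 0 <= a ^+ 8 by rewrite exprn_ge0// ltW.
  rewrite -/(wdeg A u); lra.
split=> // S T.
have K0 : 0 <= K * a ^+ 6 by rewrite mulr_ge0 ?exprn_ge0 ?(ltW a0)//; lra.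
wlog st : S T / (#|S| <= #|T|)%N.
  move=> W; have [|/ltnW] := leqP #|S| #|T|; first exact: W.
  by move=> /W; rewrite centered_cut_sym mulrC [X in _ * Num.sqrt X]mulrC mulrC.
have [S0|S0] := posnP #|S|.
  rewrite /centered_cut (cards0_eq S0) big_set0 normr0 mulr_ge0 ?sqrtr_ge0//.
have [tsa|tsa] := leP (#|T|%:R) (#|S|%:R * a ^+ 4).
  by apply/ltW/cutG; rewrite ?S0.
apply: (@le_trans _ _ (3 * a ^+ 8 * #|S|%:R)).
  apply: le_trans (ler_norm_sum _ _ _) _.
  rewrite mulr_natr -sumr_const; apply: ler_sum => u _.
  apply: le_trans (ler_norm_sum _ _ _) _.
  apply: le_trans (row u).
  by rewrite [leRHS](bigID (mem T))/= lerDl sumr_ge0.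
have sq : #|S|%:R * a ^+ 2 <= Num.sqrt (#|S|%:R * #|T|%:R).
  rewrite -(@ger0_norm _ (#|S|%:R * a ^+ 2)) ?mulr_ge0 ?exprn_ge0 ?(ltW a0)//.
  rewrite -sqrtr_sqr ler_wsqrtr// exprMn expr2 -exprM -mulrA.
  by rewrite ler_wpM2l// ltW.
apply: le_trans (ler_wpM2l K0 sq).
have -> : 3 * a ^+ 8 * #|S|%:R = 3 * (a ^+ 8 * #|S|%:R) by ring.
have -> : K * a ^+ 6 * (#|S|%:R * a ^+ 2) = K * (a ^+ 8 * #|S|%:R) by ring.
by rewrite ler_wpM2r// mulr_ge0// exprn_ge0// ltW.
Qed.

(** The dyadic cut-off k is chosen with 2^k of the order of a, so that the
    trivial part is O(a^7), while 2k+1 <= 2a makes the discrepancy part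
    O(a^6 a) as well; compared to the degrees, of order a^8, this is O(1/a). *)
Lemma pseudorandom_gap (f g : 'I_m -> R) : (4 <= m)%N -> 0 <= rho <= 1 -> 1 <= a ->
  a ^+ 8 = rho * m%:R -> 3 <= K -> pseudorandom rho a K G ->
  \sum_u \sum_v centered_adj A (wdeg A) u v * (f u * g v) <=
  gap_const K / a / 2 * (\sum_u wdeg A u * f u ^+ 2 + \sum_u wdeg A u * g u ^+ 2).
Proof.
move=> m4 rho01 a1 am K3 GP; have a0 : 0 < a by lra.
have [row disc] := pseudorandom_discrepancy m4 rho01 a1 am K3 GP.
have degA := pseudorandom_wdeg_ge m4 rho01 GP.
pose M u v := A u v - rho * (u != v)%:R.
have col v : \sum_u `|M u v| <= 3 * a ^+ 8.
  by under eq_bigr do rewrite /M /A adjr_sym eq_sym; exact: row.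
pose k := dyadic_level a.
have /andP[ka ak] := dyadic_level_itv a1; rewrite -/k in ka ak.
have k2 : (2 * k + 1)%:R <= 2 * a :> R.
  apply: (@le_trans _ _ (2 * 2 ^+ k)); last by rewrite ler_pM2l.
  rewrite -natrX -natrM ler_nat; have := ltn_expl k (isT : (1 < 2)%N); lia.
have Da : 3 * a ^+ 8 / 2 ^+ k <= 6 * a ^+ 7.
  rewrite ler_pdivrMr ?exprn_gt0//.
  have -> : 3 * a ^+ 8 = 3 * a ^+ 7 * a by ring.
  have -> : 6 * a ^+ 7 * 2 ^+ k = 3 * a ^+ 7 * 2 ^+ k.+1 by rewrite (exprS _ k); ring.
  by rewrite ler_wpM2l ?mulr_ge0 ?exprn_ge0 ?(ltW a0)// ltW.
pose k0 := 8 * K + 12; pose kap := k0 * a ^+ 7.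
have K6 : 0 <= K * a ^+ 6 by rewrite mulr_ge0 ?exprn_ge0 ?(ltW a0)//; lra.
have kapE : 2 * (2 * (K * a ^+ 6) * (2 * k + 1)%:R + 3 * a ^+ 8 / 2 ^+ k) <= kap.
  have := ler_wpM2l K6 k2; rewrite /kap /k0.
  have -> : K * a ^+ 6 * (2 * a) = 2 * K * a ^+ 7 by ring.
  lra.
have k00 : 0 < k0 by rewrite /k0; lra.
have kap0 : 0 < kap by rewrite mulr_gt0// exprn_gt0.
have Mle (x y : 'I_m -> R) : \sum_u \sum_v (A u v - rho * (u != v)%:R) * (x u * y v) <=
     kap * (\sum_u x u ^+ 2 + \sum_u y u ^+ 2).
  apply: le_trans (bilinear_le k x y K6 row col disc) _.
  by rewrite ler_wpM2r// addr_ge0// sumr_ge0// => u _; rewrite sqr_ge0.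
have D0 : 0 < rho * #|'I_m|%:R by rewrite card_ord -am exprn_gt0.
have m1 : (1 < #|'I_m|)%N by rewrite card_ord; apply: leq_trans m4.
have := @spectral_gap_centered R 'I_m A rho kap (adjr_sym R G) f g m1 rho01 D0 kap0.
rewrite card_ord => /(_ degA Mle) /le_trans; apply.
apply: ler_wpM2r.
  by rewrite addr_ge0// sumr_ge0// => u _; rewrite mulr_ge0 ?sqr_ge0// wdeg_ge0// => *;
    exact: adjr_ge0.
rewrite -am /gap_const -/k0.
have -> : 4 * (k0 + 1 + 8 * k0 ^+ 2) / a / 2 = 2 / a ^+ 8 * ((k0 + 1 + 8 * k0 ^+ 2) * a ^+ 7).
  by field; rewrite gt_eqF.
rewrite ler_wpM2l ?divr_ge0 ?exprn_ge0 ?(ltW a0)//.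
have -> : 8 * kap ^+ 2 / a ^+ 8 = 8 * k0 ^+ 2 * a ^+ 6.
  by rewrite /kap; field; rewrite gt_eqF.
have a7 : 1 <= a ^+ 7 by rewrite exprn_ege1.
have a67 : a ^+ 6 <= a ^+ 7 by rewrite ler_weXn2l.
have := ler_wpM2l (mulr_ge0 (ler0n R 8) (sqr_ge0 k0)) a67.
rewrite /kap; lra.
Qed.

Lemma gap_const_ge1 : 3 <= K -> 1 <= gap_const K.
Proof. move=> K3; rewrite /gap_const; have := sqr_ge0 (8 * K + 12); lra. Qed.

(** When the gap delta = gap_const K / a is not below 1, the claimed bound is
    not positive and lambda1 >= 0 suffices.  Otherwise [energy_ge] applies, and
    the comparison of exponents 1/(8(q-1)) >= 1/(8(p-1)) >= 1/(2p^2) amounts to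
    (p - 2)^2 >= 0. *)
Lemma pseudorandom_lambda1 (p q : R) : (4 <= m)%N -> 0 <= rho <= 1 -> 1 <= a ->
  a ^+ 8 = rho * m%:R -> 3 <= K -> pseudorandom rho a K G -> 2 <= q <= p ->
  1 - 4 * gap_const K * p ^+ 4 / (rho * m%:R) `^ (1 / (2 * p ^+ 2)) <= lambda1 G q.
Proof.
move=> m4 rho01 a1 am K3 GP /andP[q2 qp]; have a0 : 0 < a by lra.
have p2 : 2 <= p by lra.
have C1 := gap_const_ge1 K3; set C := gap_const K in C1 *.
have degA := pseudorandom_wdeg_ge m4 rho01 GP.
have D0 : 0 < rho * m%:R by rewrite -am exprn_gt0.
have deg0 u : 0 < wdeg A u by apply: lt_le_trans (degA u); rewrite divr_gt0.
have val0 u : (0 < valency G u)%N.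
  by have := deg0 u; rewrite wdeg_adjr ltr0n.
have m1 : (1 < m)%N by apply: leq_trans m4.
have psq : 4 <= p ^+ 2 by rewrite expr2; nra.
have pp0 : 0 < 2 * p ^+ 2 by lra.
have DE : rho * m%:R = a `^ 8 by rewrite powR_mulrn ?(ltW a0)// am.
pose y := a `^ (- (4 / p ^+ 2)).
have yE : ((rho * m%:R) `^ (1 / (2 * p ^+ 2)))^-1 = y.
  rewrite DE -powRrM -powRN /y; congr (_ `^ _); field.
  by rewrite gt_eqF; lra.
have y0 : 0 < y by rewrite powR_gt0.
rewrite yE.
have p4 : p <= p ^+ 4.
  by apply: ler_eXnr => //; lra.
have ya : a^-1 <= y.
  rewrite -powR_inv1 ?(ltW a0)// /y ler_powR// lerN2 ler_pdivrMr; lra.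
have [Ca|aC] := leP a C.
  apply: (@le_trans _ _ 0).
    rewrite subr_le0.
    have h1 : 1 <= C * y.
      apply: le_trans (ler_wpM2l _ ya); last lra.
      by rewrite ler_pdivlMr ?mul1r.
    have h2 : 1 <= 4 * p ^+ 4 by lra.
    have -> : 4 * C * p ^+ 4 * y = (4 * p ^+ 4) * (C * y) by ring.
    have h3 : 0 <= C * y by lra.
    by apply: le_trans h1 _; rewrite ler_peMl.
  apply: lambda1_ge => //.
  by move=> w _; rewrite mul0r penergy_ge0// => *; exact: adjr_ge0.
pose delta := C / a.
have d01 : 0 < delta <= 1.
  by rewrite /delta divr_gt0 ?ler_pdivrMr ?mul1r ?(ltW aC)//; lra.
apply: (@le_trans _ _ (1 - 4 * q * delta `^ (1 / (q - 1)))).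
  rewrite lerD2l lerN2.
  have dq : delta `^ (1 / (q - 1)) <= C * y.
    have e0 : 0 <= 1 / (q - 1) by apply: divr_ge0; lra.
    rewrite /delta powRM ?invr_ge0 ?(ltW a0)//; last lra.
    apply: ler_pM; rewrite ?powR_ge0//.
      by apply: ler1_powR => //; rewrite ler_pdivrMr; lra.
    rewrite -powR_inv1 ?(ltW a0)// -powRrM /y ler_powR// mulN1r lerN2.
    have q1 : 0 < q - 1 by lra.
    have p1 : 0 < p - 1 by lra.
    apply: (@le_trans _ _ (1 / (p - 1))).
      rewrite ler_pdivrMr; last lra.
      rewrite div1r [leRHS]mulrC ler_pdivlMr//.
      have := sqr_ge0 (p - 2); rewrite !expr2; lra.
    by rewrite !div1r lef_pV2 ?posrE//; lra.
  have -> : 4 * C * p ^+ 4 * y = 4 * p ^+ 4 * (C * y) by ring.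
  apply: ler_pM; rewrite ?mulr_ge0 ?powR_ge0//; lra.
apply: lambda1_ge => // w wB.
have vol0 : 0 < \sum_u wdeg A u.
  pose i0 : 'I_m := Ordinal (ltnW m1).
  by rewrite (bigD1 i0)//= ltr_pwDl// sumr_ge0// => u _; exact: ltW.
have := @energy_ge R 'I_m A (wdeg A) (adjr_ge0 R G) (adjr_sym R G)
  (fun u => erefl) vol0 delta d01 _ q w q2 wB.
apply => f g; exact: pseudorandom_gap.
Qed.

End assembly.

Theorem theorem1p18 (R : realType) (xi : R) (hxi : 0 < xi) :
  exists kappa C : R, 0 < kappa /\ 0 < C /\
  forall chi : nat -> R,
    (forall m, 0 < chi m) ->
    (chi @ \oo --> (0 : R))%classic ->
  exists C' : R, 0 < C' /\
  forall p : R, 2 <= p ->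
  forall (m : nat) (rho : R),
    (0 < m)%N ->
    0 <= rho <= 1 ->
    kappa * ln m%:R / m%:R <= rho <= chi m * m%:R `^ (1 / 3) / m%:R ->
    1 - C' / m%:R `^ xi <=
    gnp_prob rho (fun G : sgraph 'I_m =>
      forall p' : R, 2 <= p' <= p ->
        1 - C * p ^+ 4 / (rho * m%:R) `^ (1 / (2 * p ^+ 2))
          - C * Num.sqrt (ln m%:R) / (rho * m%:R) `^ (1 / 2) * (p' < 3)%R%:R
        <= lambda1 G p').
Proof.
pose K : R := 24 * (xi + 4).
have K3 : 3 <= K by rewrite /K; lra.
have C1 := gap_const_ge1 K3.
exists (256 * (xi + 1)), (4 * gap_const K); do 2 (split; first lra).
move=> chi _ _; exists (4 + 4 `^ xi); split.
  by rewrite ltr_pwDl// powR_ge0.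
move=> p p2 m rho m0 rho01 /andP[kr _].
have mp : 0 < m%:R :> R by rewrite ltr0n.
have x0 : 0 < m%:R `^ xi by rewrite powR_gt0.
have [m4|m4] := leqP 4 m; last first.
  apply: le_trans (gnp_prob_ge0 rho01 _); rewrite subr_le0 ler_pdivlMr// mul1r.
  have : m%:R `^ xi <= 4 `^ xi.
    by rewrite ge0_ler_powR ?nnegrE ?(ltW hxi)// ler_nat ltnW.
  lra.
have D : 256 * (xi + 1) * ln m%:R <= rho * m%:R by rewrite -ler_pdivrMr.
have ln2 : 1 / 2 <= ln m%:R :> R.
  rewrite -ler_expR lnK ?posrE//; apply: (@le_trans _ _ (expR 1)).
    by rewrite ler_expR; lra.
  by apply: le_trans (expR1_le4 R) _; rewrite ler_nat.
have D1 : 1 <= rho * m%:R.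
  apply: le_trans D; have := @ler_pM R 256 (256 * (xi + 1)) (1 / 2) (ln m%:R); lra.
(* K comes from cut_tail, kappa = 256 (xi + 1) from degree_tail *)
pose a := (rho * m%:R) `^ (1 / 8).
have a1 : 1 <= a.
  have := @ge0_ler_powR R (1 / 8) _ 1 (rho * m%:R); rewrite powR1; apply; rewrite ?nnegrE//; lra.
have am : a ^+ 8 = rho * m%:R.
  rewrite -powR_mulrn; last lra.
  by rewrite /a -powRrM div1r mulVf ?powRr1//; lra.
apply: (@le_trans _ _ (1 - 4 / m%:R `^ xi)).
  rewrite lerD2l lerN2 ler_pM2r ?invr_gt0// lerDl powR_ge0//.
apply: le_trans (pseudorandom_prob hxi rho01 a1 am m0 D) _.
apply: gnp_prob_le => // G GP q qp.
apply: le_trans (pseudorandom_lambda1 m4 rho01 a1 am K3 GP qp).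
rewrite lerBlDr lerDl mulr_ge0// divr_ge0 ?powR_ge0// mulr_ge0 ?sqrtr_ge0//; lra.
Qed.
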